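(* Let $\mathcal{I}$ be a set and let $\{f_i\colon \mathcal{T}\to \mathcal{T}_i\}_{i\in\mathcal{I}}$ be a family of geometric functors between rigidly-compactly generated tt-categories with weakly Noetherian Balmer spectrum. Let $g_i$ denote the right adjoint of $f_i$. Assume that $\mathbb{1}_{\mathcal{T}}\in \mathrm{Loc}^\otimes\left(\coprod_{i\in \mathcal{I}}g_{i}(\mathbb{1}_{\mathcal{T}_i})\right)$. If each $\mathcal{T}_i$ is stratified and the map $$\coprod_{i\in \mathcal{I}}\mathrm{Spc}(f_i)\colon \coprod_{i\in\mathcal{I}}\mathrm{Spc}(\mathcal{T}_i^c)\to \mathrm{Spc}(\mathcal{T}^c)$$ is injective, then $\mathcal{T}$ is stratified as well.
   Context: A big tt-category is a rigidly-compactly generated tensor-triangulated category $\mathcal{T}$: it has small coproducts, is generated by a set of compact objects, $\otimes$ is exact and coproduct-preserving in each variable, and the compact objects coincide with the rigid (dualizable) objects. $\mathcal{T}^c$ is its full subcategory of compact objects. A geometric functor $f\colon\mathcal{T}\to\mathcal{T}'$ between big tt-categories is a strongly monoidal triangulated functor commuting with coproducts; it has a right adjoint, it restricts to compact objects, and it induces a continuous map $\mathrm{Spc}(f)\colon\mathrm{Spc}(\mathcal{T}'^c)\to\mathrm{Spc}(\mathcal{T}^c)$, $\mathcal{Q}\mapsto \{x\in\mathcal{T}^c\mid f(x)\in\mathcal{Q}\}$. Here $\mathrm{Spc}$ is the Balmer spectrum (space of prime thick tensor-ideals). $\mathrm{Loc}^\otimes(\mathcal{X})$ denotes the localizing tensor-ideal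 generated by $\mathcal{X}$ (smallest triangulated subcategory containing $\mathcal{X}$, closed under small coproducts and under tensoring with arbitrary objects). A subset of $\mathrm{Spc}(\mathcal{T}^c)$ is Thomason if it is a union of closed subsets with quasi-compact complement. $\mathrm{Spc}(\mathcal{T}^c)$ is weakly Noetherian if for every point $\mathcal{P}$ there are Thomason subsets $Y_1,Y_2$ with $\{\mathcal{P}\}=Y_1\cap Y_2^c$. For a Thomason subset $Y$ let $e(Y)\to\mathbb{1}\to f(Y)\to \Sigma e(Y)$ be the associated idempotent triangle, i.e. $e(Y)\in\mathcal{L}_Y:=\mathrm{Loc}^\otimes(x\in\mathcal{T}^c\mid \mathrm{supp}(x)\subseteq Y)$ and $f(Y)$ is right orthogonal to $\mathcal{L}_Y$. Put $\mathbf{g}(\mathcal{P})=e(Y_1)\otimes f(Y_2)$, which is independent of the choice of $Y_1,Y_2$. A big tt-category $\mathcal{T}$ with weakly Noetherian spectrum is stratified if it satisfies: (i) the local-to-global principle: every $x\in\mathcal{T}$ lies in $\mathrm{Loc}^\otimes(\mathbf{g}(\mathcal{P})\otimes x\mid\mathcal{P}\in\mathrm{Spc}(\mathcal{T}^c))$; and (ii) minimality: for every $\mathcal{P}\in\mathrm{Spc}(\mathcal{T}^c)$, the localizing ideal $\mathrm{Loc}^\otimes(\mathbf{g}(\mathcal{P}))$ is generated, as a localizing tensor-ideal, by any nonzero object it contains. *)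

(* Defs.v *)
From HB Require Import structures.
From mathcomp Require Import all_boot all_algebra.
From mathcomp Require Import boolp classical_sets.
From mathcomp Require Import topology_structure compact.

Set Implicit Arguments.
Unset Strict Implicit.
Unset Printing Implicit Defensive.

Import GRing.Theory.
Local Open Scope classical_set_scope.
Local Open Scope ring_scope.

Declare Scope cat_scope.
Delimit Scope cat_scope with cat.
Local Open Scope cat_scope.

Reserved Notation "g ∘ f" (at level 40, left associativity).
Reserved Notation "x ⊗ y" (at level 40, left associativity).
Reserved Notation "f ⊗m g" (at level 40, left associativity).

(* One fixed universe holding both the hom-sets and the index sets of small
   families; objects may live in a larger universe. *)
Definition small := Type.

Record category := Category {
  ob :> Type;
  hom : ob -> ob -> small;
  idm : forall x, hom x x;
  comp : forall x y z, hom y z -> hom x y -> hom x z;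
  comp1m : forall x y (f : hom x y), comp (idm y) f = f;
  compm1 : forall x y (f : hom x y), comp f (idm x) = f;
  compA : forall x y z w (h : hom z w) (g : hom y z) (f : hom x y),
    comp h (comp g f) = comp (comp h g) f
}.
Arguments hom {c}.
Arguments idm {c} x.
Arguments comp {c x y z}.

Notation "g ∘ f" := (comp g f) : cat_scope.

Record preadditive := Preadditive {
  pre_cat :> category;
  hadd : forall x y : pre_cat, hom x y -> hom x y -> hom x y;
  hzero : forall x y : pre_cat, hom x y;
  hopp : forall x y : pre_cat, hom x y -> hom x y;
  haddA : forall x y, associative (@hadd x y);
  haddC : forall x y, commutative (@hadd x y);
  hadd0 : forall x y, left_id (hzero x y) (@hadd x y);
  haddN : forall x y, left_inverse (hzero x y) (@hopp x y) (@hadd x y);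
  comp_haddl : forall (x y z : pre_cat) (g g' : hom y z) (f : hom x y),
    hadd g g' ∘ f = hadd (g ∘ f) (g' ∘ f);
  comp_haddr : forall (x y z : pre_cat) (g : hom y z) (f f' : hom x y),
    g ∘ hadd f f' = hadd (g ∘ f) (g ∘ f')
}.

HB.instance Definition _ (C : preadditive) (x y : C) := gen_eqMixin (hom x y).
HB.instance Definition _ (C : preadditive) (x y : C) :=
  gen_choiceMixin (hom x y).
HB.instance Definition _ (C : preadditive) (x y : C) :=
  GRing.isZmodule.Build (hom x y)
    (@haddA C x y) (@haddC C x y) (@hadd0 C x y) (@haddN C x y).

Lemma compDl (C : preadditive) (x y z : C) (g g' : hom y z) (f : hom x y) :
  (g + g') ∘ f = g ∘ f + g' ∘ f.
Proof. exact: comp_haddl. Qed.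

Lemma compDr (C : preadditive) (x y z : C) (g : hom y z) (f f' : hom x y) :
  g ∘ (f + f') = g ∘ f + g ∘ f'.
Proof. exact: comp_haddr. Qed.

Lemma comp0m (C : preadditive) (x y z : C) (f : hom x y) :
  (0 : hom y z) ∘ f = 0.
Proof. by apply: (@addrI _ ((0 : hom y z) ∘ f)); rewrite -compDl !addr0. Qed.

Lemma compm0 (C : preadditive) (x y z : C) (g : hom y z) :
  g ∘ (0 : hom x y) = 0.
Proof. by apply: (@addrI _ (g ∘ (0 : hom x y))); rewrite -compDr !addr0. Qed.

Record iso (C : category) (x y : C) := Iso {
  fwd :> hom x y;
  bwd : hom y x;
  fwdK : bwd ∘ fwd = idm x;
  bwdK : fwd ∘ bwd = idm y
}.

Definition isomorphic (C : category) (x y : C) : Prop := inhabited (iso x y).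

Definition retract_of (C : category) (x y : C) : Prop :=
  exists (i : hom x y) (r : hom y x), r ∘ i = idm x.

Definition is_zero (C : preadditive) (z : C) : Prop :=
  forall x : C, (forall f : hom x z, f = 0) /\ (forall f : hom z x, f = 0).

Definition is_biproduct (C : preadditive) (x y b : C) : Prop :=
  exists (i : hom x b) (j : hom y b) (p : hom b x) (q : hom b y),
    [/\ p ∘ i = idm x, q ∘ j = idm y, q ∘ i = 0, p ∘ j = 0
      & i ∘ p + j ∘ q = idm b].

Definition is_coproduct (C : category) (I : small) (X : I -> C) (c : C)
    (inj : forall i, hom (X i) c) : Prop :=
  forall (y : C) (f : forall i, hom (X i) y),
    exists! h : hom c y, forall i, h ∘ inj i = f i.

Record functor (C D : category) := Functor {
  fob :> C -> D;
  fmap : forall x y : C, hom x y -> hom (fob x) (fob y);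
  fmap_id : forall x, fmap (idm x) = idm (fob x);
  fmap_comp : forall (x y z : C) (g : hom y z) (f : hom x y),
    fmap (g ∘ f) = fmap g ∘ fmap f
}.
Arguments fmap {C D} F {x y} : rename.

Definition additive_functor (C D : preadditive) (F : functor C D) : Prop :=
  forall (x y : C) (f g : hom x y), fmap F (f + g) = fmap F f + fmap F g.

Definition is_equivalence (C D : category) (F : functor C D) : Prop :=
  (forall x y : C, bijective (@fmap C D F x y)) /\
  (forall y : D, exists x : C, isomorphic (F x) y).

Definition preserves_coproducts (C D : category) (F : functor C D) : Prop :=
  forall (I : small) (X : I -> C) (c : C) (inj : forall i, hom (X i) c),
    is_coproduct inj -> is_coproduct (fun i => fmap F (inj i)).

Definition is_right_adjoint (C D : category)
    (F : functor C D) (G : functor D C) : Prop :=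
  exists phi : forall (x : C) (y : D), hom (F x) y -> hom x (G y),
    [/\ forall x y, bijective (phi x y),
        forall (x x' : C) (y : D) (f : hom (F x) y) (u : hom x' x),
          phi x' y (f ∘ fmap F u) = phi x y f ∘ u
      & forall (x : C) (y y' : D) (f : hom (F x) y) (v : hom y y'),
          phi x y' (v ∘ f) = fmap G v ∘ phi x y f].

Record triangulated := Triangulated {
  tri_pre :> preadditive;
  zero_ex : exists z : tri_pre, is_zero z;
  biproduct_ex : forall x y : tri_pre, exists b, is_biproduct x y b;
  shift : functor tri_pre tri_pre;
  shift_additive : additive_functor shift;
  shift_equiv : is_equivalence shift;
  dist : forall x y z : tri_pre,
    hom x y -> hom y z -> hom z (shift x) -> Prop;
  dist_iso : forall (x y z x' y' z' : tri_pre)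
    (f : hom x y) (g : hom y z) (h : hom z (shift x))
    (f' : hom x' y') (g' : hom y' z') (h' : hom z' (shift x'))
    (a : iso x x') (b : iso y y') (c : iso z z'),
    b ∘ f = f' ∘ a -> c ∘ g = g' ∘ b -> fmap shift a ∘ h = h' ∘ c ->
    dist f g h -> dist f' g' h';
  dist_id : forall x z : tri_pre, is_zero z ->
    dist (idm x) (0 : hom x z) (0 : hom z (shift x));
  dist_cone : forall (x y : tri_pre) (f : hom x y),
    exists (z : tri_pre) (g : hom y z) (h : hom z (shift x)), dist f g h;
  dist_rotate : forall (x y z : tri_pre)
    (f : hom x y) (g : hom y z) (h : hom z (shift x)),
    dist f g h <-> dist g h (- fmap shift f);
  dist_fill : forall (x y z x' y' z' : tri_pre)
    (f : hom x y) (g : hom y z) (h : hom z (shift x))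
    (f' : hom x' y') (g' : hom y' z') (h' : hom z' (shift x'))
    (a : hom x x') (b : hom y y'),
    dist f g h -> dist f' g' h' -> b ∘ f = f' ∘ a ->
    exists c : hom z z', c ∘ g = g' ∘ b /\ fmap shift a ∘ h = h' ∘ c;
  dist_octahedron : forall (x y z u v w : tri_pre)
    (f : hom x y) (f1 : hom y u) (f2 : hom u (shift x))
    (g : hom y z) (g1 : hom z v) (g2 : hom v (shift y))
    (h1 : hom z w) (h2 : hom w (shift x)),
    dist f f1 f2 -> dist g g1 g2 -> dist (g ∘ f) h1 h2 ->
    exists (a : hom u w) (b : hom w v),
      [/\ dist a b (fmap shift f1 ∘ g2),
          a ∘ f1 = h1 ∘ g, h2 ∘ a = f2, b ∘ h1 = g1
        & g2 ∘ b = fmap shift f ∘ h2]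
}.
Arguments shift {t}.
Arguments dist {t x y z}.

Definition exact_functor (C D : triangulated) (F : functor C D) : Prop :=
  additive_functor F /\
  exists s : forall x : C, iso (F (shift x)) (shift (F x)),
    (forall (x y : C) (f : hom x y),
      s y ∘ fmap F (fmap shift f) = fmap shift (fmap F f) ∘ s x) /\
    (forall (x y z : C) (f : hom x y) (g : hom y z) (h : hom z (shift x)),
      dist f g h -> dist (fmap F f) (fmap F g) (s x ∘ fmap F h)).

Record sym_monoidal (C : category) := SymMonoidal {
  tens : C -> C -> C;
  tensm : forall x x' y y' : C,
    hom x x' -> hom y y' -> hom (tens x y) (tens x' y');
  tensm_id : forall x y, tensm (idm x) (idm y) = idm (tens x y);
  tensm_comp : forall (x x' x'' y y' y'' : C)
    (f' : hom x' x'') (f : hom x x') (g' : hom y' y'') (g : hom y y'),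
    tensm (f' ∘ f) (g' ∘ g) = tensm f' g' ∘ tensm f g;
  tunit : C;
  tassoc : forall x y z, iso (tens (tens x y) z) (tens x (tens y z));
  lunit : forall x, iso (tens tunit x) x;
  runit : forall x, iso (tens x tunit) x;
  braid : forall x y, iso (tens x y) (tens y x);
  tassoc_nat : forall (x x' y y' z z' : C)
    (f : hom x x') (g : hom y y') (h : hom z z'),
    tassoc x' y' z' ∘ tensm (tensm f g) h
    = tensm f (tensm g h) ∘ tassoc x y z;
  lunit_nat : forall (x y : C) (f : hom x y),
    lunit y ∘ tensm (idm tunit) f = f ∘ lunit x;
  runit_nat : forall (x y : C) (f : hom x y),
    runit y ∘ tensm f (idm tunit) = f ∘ runit x;
  braid_nat : forall (x x' y y' : C) (f : hom x x') (g : hom y y'),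
    braid x' y' ∘ tensm f g = tensm g f ∘ braid x y;
  pentagon : forall w x y z,
    tassoc w x (tens y z) ∘ tassoc (tens w x) y z
    = tensm (idm w) (tassoc x y z) ∘ tassoc w (tens x y) z
      ∘ tensm (tassoc w x y) (idm z);
  triangle : forall x y,
    tensm (idm x) (lunit y) ∘ tassoc x tunit y = tensm (runit x) (idm y);
  lunit_runit : lunit tunit = runit tunit :> hom _ _;
  braid_braid : forall x y, braid y x ∘ braid x y = idm (tens x y);
  hexagon : forall x y z,
    tassoc y z x ∘ braid x (tens y z) ∘ tassoc x y z
    = tensm (idm y) (braid x z) ∘ tassoc y x z
      ∘ tensm (braid x y) (idm z)
}.
Arguments tens {C} s.
Arguments tensm {C} s {x x' y y'}.
Arguments tunit {C} s.

Section TensorFunctors.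
Variables (C : category) (M : sym_monoidal C) (x : C).

Let tensl_id y : tensm M (idm x) (idm y) = idm (tens M x y).
Proof. exact: tensm_id. Qed.

Let tensl_comp (y z w : C) (g : hom z w) (f : hom y z) :
  tensm M (idm x) (g ∘ f) = tensm M (idm x) g ∘ tensm M (idm x) f.
Proof. by rewrite -tensm_comp comp1m. Qed.

Definition tensl : functor C C := Functor tensl_id tensl_comp.

Let tensr_id y : tensm M (idm y) (idm x) = idm (tens M y x).
Proof. exact: tensm_id. Qed.

Let tensr_comp (y z w : C) (g : hom z w) (f : hom y z) :
  tensm M (g ∘ f) (idm x) = tensm M g (idm x) ∘ tensm M f (idm x).
Proof. by rewrite -tensm_comp comp1m. Qed.

Definition tensr : functor C C := Functor tensr_id tensr_comp.
End TensorFunctors.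

Definition rigid_ob (C : category) (M : sym_monoidal C) (x : C) : Prop :=
  exists (y : C) (ev : hom (tens M y x) (tunit M))
         (coev : hom (tunit M) (tens M x y)),
    runit M x ∘ tensm M (idm x) ev ∘ tassoc M x y x
      ∘ tensm M coev (idm x) ∘ bwd (lunit M x) = idm x
    /\
    lunit M y ∘ tensm M ev (idm y) ∘ bwd (tassoc M y x y)
      ∘ tensm M (idm y) coev ∘ bwd (runit M y) = idm y.

Definition strong_monoidal (C D : category) (M : sym_monoidal C)
    (N : sym_monoidal D) (F : functor C D) : Prop :=
  exists (m : forall x y : C, iso (tens N (F x) (F y)) (F (tens M x y)))
         (e : iso (tunit N) (F (tunit M))),
    [/\ forall (x x' y y' : C) (f : hom x x') (g : hom y y'),
          m x' y' ∘ tensm N (fmap F f) (fmap F g)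
          = fmap F (tensm M f g) ∘ m x y,
        forall x y z : C,
          fmap F (tassoc M x y z) ∘ m (tens M x y) z
            ∘ tensm N (m x y) (idm (F z))
          = m x (tens M y z) ∘ tensm N (idm (F x)) (m y z)
            ∘ tassoc N (F x) (F y) (F z),
        forall x : C,
          fmap F (lunit M x) ∘ m (tunit M) x ∘ tensm N e (idm (F x))
          = lunit N (F x)
      & forall x : C,
          fmap F (runit M x) ∘ m x (tunit M) ∘ tensm N (idm (F x)) e
          = runit N (F x)].

Section MonoidalLemmas.
Variables (C : category) (M : sym_monoidal C).
Local Notation "x ⊗ y" := (tens M x y) : cat_scope.
Local Notation "f ⊗m g" := (tensm M f g) : cat_scope.
Local Notation "'𝟙'" := (tunit M) : cat_scope.

Lemma iso_injl (x y z : C) (a : iso y z) (f g : hom x y) :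
  a ∘ f = a ∘ g -> f = g.
Proof. by move=> /(congr1 (comp (bwd a))); rewrite !compA fwdK !comp1m. Qed.

Lemma iso_injr (x y z : C) (a : iso x y) (f g : hom y z) :
  f ∘ a = g ∘ a -> f = g.
Proof.
by move=> /(congr1 (fun h => h ∘ bwd a)); rewrite -!compA bwdK !compm1.
Qed.

Lemma tensm_split (x x' y y' : C) (f : hom x x') (g : hom y y') :
  f ⊗m g = (f ⊗m idm y') ∘ (idm x ⊗m g).
Proof. by rewrite -tensm_comp comp1m compm1. Qed.

Lemma tensml_comp (x y z w : C) (g : hom y z) (f : hom x y) :
  idm w ⊗m (g ∘ f) = (idm w ⊗m g) ∘ (idm w ⊗m f).
Proof. by rewrite -tensm_comp comp1m. Qed.

Lemma tensmr_comp (x y z w : C) (g : hom y z) (f : hom x y) :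
  (g ∘ f) ⊗m idm w = (g ⊗m idm w) ∘ (f ⊗m idm w).
Proof. by rewrite -tensm_comp comp1m. Qed.

Lemma tens1r_inj (x y : C) (f g : hom x y) :
  f ⊗m idm 𝟙 = g ⊗m idm 𝟙 -> f = g.
Proof.
move=> E; apply: (@iso_injr _ _ _ (runit M x)).
by rewrite -!runit_nat E.
Qed.

Lemma runit_tens (x y : C) :
  (idm x ⊗m runit M y) ∘ tassoc M x y 𝟙 = runit M (x ⊗ y).
Proof.
apply: tens1r_inj; apply: (@iso_injl _ _ _ (tassoc M x y 𝟙)).
rewrite tensmr_comp compA tassoc_nat -triangle tensml_comp.
rewrite -!compA [X in _ ∘ X]compA -pentagon compA -tassoc_nat tensm_id.
by rewrite -!compA triangle.
Qed.

Lemma rigid_unit : rigid_ob M 𝟙.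
Proof.
have E : tensm M (lunit M 𝟙) (idm 𝟙)
    = tensm M (idm 𝟙) (lunit M 𝟙) ∘ tassoc M 𝟙 𝟙 𝟙.
  by rewrite triangle lunit_runit.
exists 𝟙, (lunit M 𝟙), (bwd (lunit M 𝟙)); split.
  rewrite -[runit M 𝟙 ∘ _ ∘ _]compA -E -[_ ∘ _ ∘ (bwd _ ⊗m _)]compA.
  by rewrite -tensmr_comp bwdK tensm_id compm1 -lunit_runit bwdK.
rewrite E -!compA [tassoc _ _ _ _ ∘ _]compA bwdK comp1m.
by rewrite [(_ ⊗m lunit _ _) ∘ _]compA -tensml_comp bwdK tensm_id comp1m
  lunit_runit bwdK.
Qed.

(* A triangle identity of the adjunction between [- ⊗ x] and [- ⊗ y], for [y]
   dual to [x]. *)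
Lemma rigid_transpose (x y z : C) (ev : hom (y ⊗ x) 𝟙) (coev : hom 𝟙 (x ⊗ y)) :
  runit M x ∘ (idm x ⊗m ev) ∘ tassoc M x y x ∘ (coev ⊗m idm x)
    ∘ bwd (lunit M x) = idm x ->
  runit M (z ⊗ x) ∘ (idm (z ⊗ x) ⊗m ev) ∘ tassoc M (z ⊗ x) y x
    ∘ ((bwd (tassoc M z x y) ∘ (idm z ⊗m coev) ∘ bwd (runit M z)) ⊗m idm x)
  = idm (z ⊗ x).
Proof.
move=> H; rewrite -runit_tens -(tensm_id M z x).
rewrite -[_ ∘ tassoc M z x 𝟙 ∘ _]compA tassoc_nat.
rewrite compA -[_ ∘ tassoc M z x _ ∘ tassoc _ _ _ _]compA pentagon !tensmr_comp.
rewrite !compA -[_ ∘ (tassoc M z x y ⊗m _) ∘ _]compA -tensmr_comp bwdK.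
rewrite tensm_id compm1 -[_ ∘ tassoc _ _ _ _ ∘ (_ ⊗m _ ⊗m _)]compA tassoc_nat.
have -> : idm z ⊗m idm x = idm z ⊗m (runit M x ∘ (idm x ⊗m ev)
   ∘ tassoc M x y x ∘ (coev ⊗m idm x) ∘ bwd (lunit M x)) by rewrite H.
rewrite !tensml_comp !compA -compA; congr (_ ∘ _).
apply: (@iso_injr _ _ _ (Iso (fwd := runit M z ⊗m idm x)
   (bwd := bwd (runit M z) ⊗m idm x) _ _)) => /=.
- by rewrite -tensmr_comp fwdK tensm_id.
- by rewrite -tensmr_comp bwdK tensm_id.
- move=> ? ?; rewrite -compA -tensmr_comp fwdK tensm_id compm1 -triangle.
  by rewrite compA -tensml_comp fwdK tensm_id comp1m.
Qed.

End MonoidalLemmas.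

Lemma rigid_image (C D : category) (M : sym_monoidal C) (N : sym_monoidal D)
    (F : functor C D) (x : C) :
  strong_monoidal M N F -> rigid_ob M x -> rigid_ob N (F x).
Proof.
move=> [m [e [mnat massoc ml mr]]] [y [ev [coev [H1 H2]]]].
pose ev' := bwd e ∘ fmap F ev ∘ m y x.
pose coev' := bwd (m x y) ∘ fmap F coev ∘ e.
have mr' z : runit N (F z) ∘ tensm N (idm (F z)) (bwd e)
    = fmap F (runit M z) ∘ m z (tunit M).
  by rewrite -mr -compA -tensml_comp bwdK tensm_id compm1.
have ml' z : lunit N (F z) ∘ tensm N (bwd e) (idm (F z))
    = fmap F (lunit M z) ∘ m (tunit M) z.
  by rewrite -ml -compA -tensmr_comp bwdK tensm_id compm1.
have ml2 z : m (tunit M) z ∘ tensm N e (idm (F z)) ∘ bwd (lunit N (F z))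
    = fmap F (bwd (lunit M z)).
  rewrite -[LHS]comp1m -fmap_id -(fwdK (lunit M z)) fmap_comp -[LHS]compA.
  by rewrite ![fmap F (lunit M z) ∘ _]compA ml bwdK compm1.
have mr2 z : m z (tunit M) ∘ tensm N (idm (F z)) e ∘ bwd (runit N (F z))
    = fmap F (bwd (runit M z)).
  rewrite -[LHS]comp1m -fmap_id -(fwdK (runit M z)) fmap_comp -[LHS]compA.
  by rewrite ![fmap F (runit M z) ∘ _]compA mr bwdK compm1.
have mnatl z u v (f : hom u v) : m z v ∘ tensm N (idm (F z)) (fmap F f)
    = fmap F (tensm M (idm z) f) ∘ m z u by rewrite -mnat fmap_id.
have mnatr z u v (f : hom u v) : m v z ∘ tensm N (fmap F f) (idm (F z))
    = fmap F (tensm M f (idm z)) ∘ m u z by rewrite -mnat fmap_id.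
have massoc' u v w : m (tens M u v) w ∘ tensm N (m u v) (idm (F w))
      ∘ bwd (tassoc N (F u) (F v) (F w))
    = fmap F (bwd (tassoc M u v w)) ∘ m u (tens M v w)
      ∘ tensm N (idm (F u)) (m v w).
  apply: (@iso_injr _ _ _ _ (tassoc N (F u) (F v) (F w))).
  rewrite -[LHS]compA fwdK compm1 -!compA [m u _ ∘ _]compA -massoc.
  by rewrite !compA -fmap_comp fwdK fmap_id comp1m.
exists (F y), ev', coev'; split.
  rewrite /ev' /coev' !tensml_comp !tensmr_comp !compA mr'.
  rewrite -[_ ∘ m x _ ∘ _]compA mnatl !compA.
  rewrite -[_ ∘ m x _ ∘ _]compA -[_ ∘ (_ ∘ _) ∘ tassoc _ _ _ _]compA -massoc.
  rewrite !compA -[_ ∘ tensm N (m x y) _ ∘ _]compA -tensmr_comp bwdK tensm_id.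
  rewrite compm1 -[_ ∘ m (tens M x y) x ∘ _]compA mnatr.
  by rewrite !compA -[_ ∘ m (tunit M) x ∘ _]compA -[_ ∘ (_ ∘ _) ∘ bwd _]compA
    ml2 -!fmap_comp H1 fmap_id.
rewrite /ev' /coev' !tensml_comp !tensmr_comp !compA ml'.
rewrite -[_ ∘ m _ y ∘ _]compA mnatr !compA.
rewrite -[_ ∘ m _ y ∘ _]compA -[_ ∘ (_ ∘ _) ∘ bwd (tassoc _ _ _ _)]compA massoc'.
rewrite !compA -[_ ∘ tensm N _ (m x y) ∘ _]compA -tensml_comp bwdK tensm_id.
rewrite compm1 -[_ ∘ m y (tens M x y) ∘ _]compA mnatl.
by rewrite !compA -[_ ∘ m y (tunit M) ∘ _]compA -[_ ∘ (_ ∘ _) ∘ bwd _]compA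
  mr2 -!fmap_comp H2 fmap_id.
Qed.

Record has_coproducts (C : category) := HasCoproducts {
  coprod : forall I : small, (I -> C) -> C;
  inj : forall (I : small) (X : I -> C) (i : I), hom (X i) (coprod X);
  coprodP : forall (I : small) (X : I -> C), is_coproduct (inj X)
}.
Arguments coprod {C} h {I} X.
Arguments inj {C} h {I} X i.
Arguments coprodP {C} h {I} X [y].

(* Surjectivity of the canonical map from the direct sum of the groups
   hom c (X i) to hom c (coprod X); that map is always injective because each
   inj i has a retraction killing the other inj j. *)
Definition compact_ob (C : preadditive) (S : has_coproducts C) (c : C) : Prop :=
  forall (I : small) (X : I -> C) (f : hom c (coprod S X)),
    exists (s : seq I) (g : forall i, hom c (X i)),
      f = \sum_(i <- s) (inj S X i ∘ g i).

(* Triangulated subcategories of the full subcategory [D]: closure under shifts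
   and isomorphisms is covered by two-out-of-three, applied to the triangles
   x -> 0 -> shift x and x -> y -> 0. *)
Record triangulated_in (C : triangulated) (D S : set C) : Prop := TriangulatedIn {
  tri_sub : S `<=` D;
  tri_zero : forall z, is_zero z -> S z;
  tri_two_of_three : forall (x y z : C)
    (f : hom x y) (g : hom y z) (h : hom z (shift x)),
    dist f g h -> D x -> D y -> D z ->
    [/\ S x -> S y -> S z, S y -> S z -> S x & S x -> S z -> S y]
}.

Record localizing (C : triangulated) (cop : has_coproducts C) (S : set C) : Prop :=
  Localizing {
  loc_tri : triangulated_in setT S;
  loc_coprod : forall (I : small) (X : I -> C),
    (forall i, S (X i)) -> S (coprod cop X)
}.

Record bigtt := BigTT {
  tt_tri :> triangulated;
  tt_mon : sym_monoidal tt_tri;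
  tt_cop : has_coproducts tt_tri;
  tensl_exact : forall x : tt_tri, exact_functor (tensl tt_mon x : functor tt_tri tt_tri);
  tensr_exact : forall x : tt_tri, exact_functor (tensr tt_mon x : functor tt_tri tt_tri);
  tensl_coprod : forall x : tt_tri, preserves_coproducts (tensl tt_mon x);
  tensr_coprod : forall x : tt_tri, preserves_coproducts (tensr tt_mon x);
  tt_generated : exists (J : small) (G : J -> tt_tri),
    (forall j, compact_ob tt_cop (G j)) /\
    (forall S : set tt_tri,
      localizing tt_cop S -> (forall j, S (G j)) -> forall x, S x);
  compact_rigid : forall x : tt_tri, compact_ob tt_cop x <-> rigid_ob tt_mon x
}.

Notation "x ⊗ y" := (tens (tt_mon _) x y) : cat_scope.
Notation "f ⊗m g" := (tensm (tt_mon _) f g) : cat_scope.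
Notation "'𝟙'" := (tunit (tt_mon _)) : cat_scope.

Definition compacts (T : bigtt) : set T := [set x | compact_ob (tt_cop T) x].

Record geometric (T T' : bigtt) := Geometric {
  geo_fun :> functor T T';
  geo_monoidal : strong_monoidal (tt_mon T) (tt_mon T') geo_fun;
  geo_exact : exact_functor (geo_fun : functor T T');
  geo_coprod : preserves_coproducts geo_fun
}.

Lemma fmap0 (C D : preadditive) (F : functor C D) (x y : C) :
  additive_functor F -> fmap F (0 : hom x y) = 0.
Proof.
by move=> FD; apply: (@addrI _ (fmap F (0 : hom x y))); rewrite -FD !addr0.
Qed.

Lemma fmap_sum (C D : preadditive) (F : functor C D) (x y : C) (I : Type)
    (s : seq I) (f : I -> hom x y) :
  additive_functor F -> fmap F (\sum_(i <- s) f i) = \sum_(i <- s) fmap F (f i).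
Proof.
move=> FD; elim: s => [|i s IH]; first by rewrite !big_nil fmap0.
by rewrite !big_cons FD IH.
Qed.

Lemma comp_suml (C : preadditive) (x y z : C) (I : Type) (s : seq I)
    (g : I -> hom y z) (f : hom x y) :
  (\sum_(i <- s) g i) ∘ f = \sum_(i <- s) (g i ∘ f).
Proof.
elim: s => [|i s IH]; first by rewrite !big_nil comp0m.
by rewrite !big_cons compDl IH.
Qed.

Lemma comp_sumr (C : preadditive) (x y z : C) (I : Type) (s : seq I)
    (g : hom y z) (f : I -> hom x y) :
  g ∘ (\sum_(i <- s) f i) = \sum_(i <- s) (g ∘ f i).
Proof.
elim: s => [|i s IH]; first by rewrite !big_nil compm0.
by rewrite !big_cons compDr IH.
Qed.

Lemma compacts_unit (T : bigtt) : @compacts T 𝟙.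
Proof. by apply/compact_rigid; exact: rigid_unit. Qed.

Lemma compacts_zero (T : bigtt) (z : T) : is_zero z -> compacts z.
Proof.
move=> z0 I X f; exists [::], (fun=> 0); rewrite big_nil.
exact: (z0 _).2.
Qed.

Lemma compacts_tens (T : bigtt) (x z : T) :
  compacts x -> compacts z -> compacts (z ⊗ x).
Proof.
move=> /compact_rigid [y [ev [coev [H _]]]] cz I X.
pose M := tt_mon T; set c := coprod (tt_cop T) X => f.
have ly := @tensr_coprod T y I X c (inj (tt_cop T) X) (coprodP (tt_cop T) X).
pose d := coprod (tt_cop T) (fun i => X i ⊗ y).
pose injd := inj (tt_cop T) (fun i => X i ⊗ y).
have [t [tE _]] := ly d injd.
have [v [vE _]] := coprodP (tt_cop T) (fun i => X i ⊗ y)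
  (fun i => fmap (tensr M y) (inj (tt_cop T) X i)).
have vt : v ∘ t = idm (c ⊗ y).
  have [w [_ wU]] := ly _ (fun i => fmap (tensr M y) (inj (tt_cop T) X i)).
  have <- : w = v ∘ t by apply: wU => i; rewrite -compA [X in _ ∘ X]tE vE.
  by apply: wU => i; exact: comp1m.
pose eta := bwd (tassoc M z x y) ∘ (idm z ⊗m coev) ∘ bwd (runit M z).
pose eps (b : T) : hom ((b ⊗ y) ⊗ x) b :=
  runit M b ∘ (idm b ⊗m ev) ∘ tassoc M b y x.
have epsN (a b : T) (h : hom a b) :
    eps b ∘ ((h ⊗m idm y) ⊗m idm x) = h ∘ eps a.
  rewrite /eps -[LHS]compA tassoc_nat tensm_id !compA.
  rewrite -[runit M b ∘ _ ∘ _]compA -tensm_comp comp1m compm1 tensm_split.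
  by rewrite !compA runit_nat.
have [s [g gE]] := cz _ _ (t ∘ ((f ⊗m idm y) ∘ eta)).
exists s, (fun i => eps (X i) ∘ (g i ⊗m idm x)).
have fE : f = eps c ∘ (((f ⊗m idm y) ∘ eta) ⊗m idm x).
  rewrite tensmr_comp compA epsN -compA.
  by rewrite /eps /eta (@rigid_transpose _ M x y z ev coev H) compm1.
have kE : (f ⊗m idm y) ∘ eta = \sum_(i <- s) (v ∘ (injd i ∘ g i)).
  by rewrite -comp_sumr -gE [RHS]compA vt comp1m.
rewrite fE kE.
rewrite [X in _ ∘ X](fmap_sum (F := tensr M x) _ _ (tensr_exact x).1).
rewrite comp_sumr; apply: eq_bigr => i _ /=.
by rewrite compA vE /= tensmr_comp [LHS]compA epsN -[LHS]compA.
Qed.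

Record localizing_ideal (T : bigtt) (S : set T) : Prop := LocalizingIdeal {
  locid_loc : localizing (tt_cop T) S;
  locid_tens : forall x y : T, S x -> S (y ⊗ x)
}.

Definition Loc (T : bigtt) (X : set T) : set T :=
  [set t | forall S : set T, localizing_ideal S -> X `<=` S -> S t].

Record prime_ideal (T : bigtt) (P : set T) : Prop := PrimeIdeal {
  prime_tri : triangulated_in (@compacts T) P;
  prime_retract : forall x y : T, compacts x -> retract_of x y -> P y -> P x;
  prime_tens : forall x y : T, P x -> compacts y -> P (y ⊗ x);
  prime_proper : ~ P 𝟙;
  prime_prime : forall x y : T, compacts x -> compacts y ->
    P (x ⊗ y) -> P x \/ P y
}.

Definition Spc (T : bigtt) : Type := {P : set T | prime_ideal P}.

Definition supp (T : bigtt) (x : T) : set (Spc T) := [set P | ~ sval P x].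

HB.instance Definition _ (T : bigtt) := gen_eqMixin (Spc T).
HB.instance Definition _ (T : bigtt) := gen_choiceMixin (Spc T).
(* The sets of primes containing x, for x compact, generate the topology (and
   form a basis: those of x and y intersect in that of their direct sum). *)
HB.instance Definition _ (T : bigtt) :=
  isSubBaseTopological.Build (Spc T)
    [set ~` supp x | x in @compacts T] id.

Definition thomason (X : topologicalType) (Y : set X) : Prop :=
  exists F : set (set X),
    (forall Z, F Z -> closed Z /\ compact (~` Z)) /\ Y = \bigcup_(Z in F) Z.

Definition weakly_noetherian (X : topologicalType) : Prop :=
  forall p : X, exists Y1 Y2 : set X,
    [/\ thomason Y1, thomason Y2 & [set p] = Y1 `&` ~` Y2].

Section SpcMap.
Variables (T T' : bigtt) (f : geometric T T').

Lemma geometric_compacts (x : T) : compacts x -> compacts (f x).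
Proof.
by move=> /compact_rigid xr; apply/compact_rigid;
  exact: rigid_image (geo_monoidal f) xr.
Qed.

Lemma prime_iso (P : set T') (x y : T') :
  prime_ideal P -> compacts x -> isomorphic x y -> P y -> P x.
Proof.
by move=> Pp cx [a]; apply: prime_retract => //; exists a, (bwd a); exact: fwdK.
Qed.

Lemma preimage_prime (Q : set T') :
  prime_ideal Q -> prime_ideal [set x : T | compacts x /\ Q (f x)].
Proof.
move=> Qp; have [fadd [s [_ fdist]]] := geo_exact f.
have [m [e _]] := geo_monoidal f.
split.
- split=> [x []//|z z0|x y z u v w /fdist D cx cy cz].
    split; first exact: compacts_zero.
    apply: tri_zero (prime_tri Qp) _ _ => x.
    have id0 : idm (f z) = 0.
      by rewrite -fmap_id (_ : idm z = 0) ?fmap0//; exact: (z0 z).1.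
    by split=> h; [rewrite -(comp1m h) id0 comp0m|rewrite -(compm1 h) id0 compm0].
  have [H1 H2 H3] := tri_two_of_three (prime_tri Qp) D (geometric_compacts cx)
    (geometric_compacts cy) (geometric_compacts cz).
  by split=> -[_ q1] [_ q2]; split=> //; [exact: H1|exact: H2|exact: H3].
- move=> x y cx [i [r ri]] [cy Qy]; split=> //.
  apply: (prime_retract Qp) Qy; first exact: geometric_compacts.
  by exists (fmap f i), (fmap f r); rewrite -fmap_comp ri fmap_id.
- move=> x y [cx Qx] cy; have cyx := compacts_tens cx cy; split=> //.
  apply: (@prime_iso _ _ (f y ⊗ f x)) => //.
  + exact: geometric_compacts.
  + by constructor; exact: Iso (bwdK (m y x)) (fwdK (m y x)).
  + by apply: (prime_tens Qp) => //; exact: geometric_compacts.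
- move=> [_ Q1]; apply: (prime_proper Qp).
  apply: prime_iso Qp _ _ Q1; first exact: compacts_unit.
  by constructor; exact: e.
- move=> x y cx cy [cxy Qxy].
  have Qt : Q (f x ⊗ f y).
    apply: prime_iso Qp _ _ Qxy; last by constructor; exact: m.
    by apply: compacts_tens; exact: geometric_compacts.
  have [Qx|Qy] := prime_prime Qp (geometric_compacts cx)
    (geometric_compacts cy) Qt; by [left|right].
Qed.

Definition Spc_map (Q : Spc T') : Spc T :=
  exist _ _ (preimage_prime (svalP Q)).
End SpcMap.

Section Stratification.
Variable T : bigtt.

Definition Loc_supp (Y : set (Spc T)) : set T :=
  Loc [set x | compacts x /\ supp x `<=` Y].

(* The idempotent triangle e(Y) -> 𝟙 -> f(Y) -> shift e(Y) is only determined
   up to isomorphism, hence a predicate on [e] and [f] instead of a choice; the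
   same goes for the object g(P) below. *)
Definition idempotent_triangle (Y : set (Spc T)) (e f : T) : Prop :=
  exists (a : hom e 𝟙) (b : hom 𝟙 f) (c : hom f (shift e)),
    [/\ dist a b c, Loc_supp Y e
      & forall y : T, Loc_supp Y y -> forall h : hom y f, h = 0].

Definition is_g (P : Spc T) (G : T) : Prop :=
  exists (Y1 Y2 : set (Spc T)) (e1 f1 e2 f2 : T),
    [/\ thomason Y1, thomason Y2, [set P] = Y1 `&` ~` Y2,
        idempotent_triangle Y1 e1 f1 /\ idempotent_triangle Y2 e2 f2
      & G = e1 ⊗ f2].

Definition local_to_global : Prop :=
  forall x : T, Loc [set y | exists P G, is_g P G /\ y = G ⊗ x] x.

Definition minimality : Prop :=
  forall (P : Spc T) (G : T), is_g P G ->
  forall y : T, Loc [set G] y -> ~ is_zero y -> Loc [set y] = Loc [set G].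

Definition stratified : Prop :=
  weakly_noetherian (Spc T) /\ local_to_global /\ minimality.
End Stratification.

(* Main.v *)
Require Import Defs.
From mathcomp Require Import all_boot all_algebra.
From mathcomp Require Import boolp classical_sets.
From mathcomp Require Import topology_structure compact.

Set Implicit Arguments.
Unset Strict Implicit.
Unset Printing Implicit Defensive.

Import GRing.Theory Defs.
Local Open Scope classical_set_scope.
Local Open Scope ring_scope.
Local Open Scope cat_scope.

(* The adjunctions satisfy the projection formula [x ⊗ g s = g (f x ⊗ s)], so
   that [f x] in [Loc (f X)] implies [g 1 ⊗ x] in [Loc X]; since the unit lies
   in the localizing ideal generated by the [g_i 1], membership in a localizing
   ideal of [T] can be tested after applying all the [f_i].  Geometric functors
   preserve idempotent triangles, [f (e Y) = e (Spc(f)^-1 Y)], hence [f_i]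
   sends [g(P)] to [g(Q)] if [Q] is the only point of the fibre of [Spc(f_i)]
   over [P], and to zero if that fibre is empty.  By injectivity at most one
   [f_i] does not kill [g(P)], and for this one minimality at [P] reduces to
   minimality at [Q].

   The idempotent triangles are built as cellular approximations (a telescope of
   iterated cones on maps from compact objects), which needs the compact objects
   to be essentially small; this follows from Neeman's theorem that every
   compact object is a retract of a finite extension of shifted generators.

   Instead of choosing shift isomorphisms for the right adjoint, exactness
   arguments are run on the bijections [hom c a = hom (f c) b], [c] compact,
   with the five lemma. *)

(** * Categories and triangles *)

(** The support arguments rest on one consequence of rigidity: thick ideals of compact objects are
    radical. Hence a compact object lies in a thick ideal as soon as each point of its support lies
    in the support of some member. Applied to the annihilator of an object [w], this makes the
    vanishing of [z ⊗ w] a pointwise question on the support of [z], which is how images of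
    idempotent triangles are recognised without knowing which compact objects lie in the image of a
    functor. The objects g(P) are compared only through the localizing ideals they generate, so no
    isomorphism between two of them is ever constructed. Injectivity enters minimality in two ways:
    across two indices it leaves a single functor to examine, and within one index it makes the
    fibre a single point, so that the image of g(P) lies in the ideal generated by g(Q). *)

Section Isomorphisms.
Variable C : category.

Definition iso_refl (x : C) : iso x x := Iso (comp1m (idm x)) (comp1m (idm x)).

Definition iso_sym (x y : C) (a : iso x y) : iso y x := Iso (bwdK a) (fwdK a).

Lemma isoK (x y z : C) (a : iso x y) (f : hom z x) : bwd a ∘ (a ∘ f) = f.
Proof. by rewrite compA fwdK comp1m. Qed.

Lemma isoKV (x y z : C) (a : iso x y) (f : hom z y) : a ∘ (bwd a ∘ f) = f.
Proof. by rewrite compA bwdK comp1m. Qed.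

Definition iso_trans (x y z : C) (a : iso x y) (b : iso y z) : iso x z.
Proof.
apply: (@Iso _ _ _ (b ∘ a) (bwd a ∘ bwd b)).
  by rewrite -compA isoK fwdK.
by rewrite -compA isoKV bwdK.
Defined.

Lemma isomorphic_refl (x : C) : isomorphic x x.
Proof. by constructor; exact: iso_refl. Qed.

Lemma isomorphic_sym (x y : C) : isomorphic x y -> isomorphic y x.
Proof. by move=> [a]; constructor; exact: iso_sym. Qed.

Lemma isomorphic_trans (x y z : C) :
  isomorphic x y -> isomorphic y z -> isomorphic x z.
Proof. by move=> [a] [b]; constructor; exact: iso_trans a b. Qed.

Definition iso_of (x y : C) (H : isomorphic x y) : iso x y.
Proof.
have /cid[a _] : exists a : iso x y, True by case: H => a; exists a.
exact: a.
Qed.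

End Isomorphisms.

Definition fmap_iso (C D : category) (F : functor C D) (x y : C)
  (a : iso x y) : iso (F x) (F y).
Proof.
apply: (@Iso _ _ _ (fmap F a) (fmap F (bwd a))).
  by rewrite -fmap_comp fwdK fmap_id.
by rewrite -fmap_comp bwdK fmap_id.
Defined.

Definition comp_functor (C D E : category) (G : functor D E) (F : functor C D) :
  functor C E.
Proof.
apply: (@Functor _ _ (fun x => G (F x)) (fun x y f => fmap G (fmap F f))).
  by move=> x; rewrite !fmap_id.
by move=> x y z g f; rewrite !fmap_comp.
Defined.

Lemma comp_retract (C : category) (x y z : C) (p : hom y x) (i : hom x y)
  (u : hom z x) : p ∘ i = idm x -> p ∘ (i ∘ u) = u.
Proof. by move=> E; rewrite compA E comp1m. Qed.

Section Preadditive.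
Variable C : preadditive.

Lemma comp_zero (w x y z : C) (q : hom y w) (i : hom x y) (u : hom z x) :
  q ∘ i = 0 -> q ∘ (i ∘ u) = 0.
Proof. by move=> E; rewrite compA E comp0m. Qed.

Lemma compNl (x y z : C) (g : hom y z) (f : hom x y) : (- g) ∘ f = - (g ∘ f).
Proof. by apply: (@addrI _ (g ∘ f)); rewrite -compDl !subrr comp0m. Qed.

Lemma compNr (x y z : C) (g : hom y z) (f : hom x y) : g ∘ (- f) = - (g ∘ f).
Proof. by apply: (@addrI _ (g ∘ f)); rewrite -compDr !subrr compm0. Qed.

Lemma is_zeroP (z : C) : is_zero z <-> idm z = 0.
Proof.
split=> [z0|E x]; first exact: (z0 z).1.
by split=> f; [rewrite -(comp1m f) E comp0m|rewrite -(compm1 f) E compm0].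
Qed.

Lemma is_zero_retract (x z : C) : retract_of x z -> is_zero z -> is_zero x.
Proof.
by move=> [i [r ri]] z0; apply/is_zeroP; rewrite -ri ((z0 x).2 r) comp0m.
Qed.

Lemma is_zero_iso (x z : C) : isomorphic x z -> is_zero z -> is_zero x.
Proof.
by move=> [a]; apply: is_zero_retract; exists a, (bwd a); exact: fwdK.
Qed.

Lemma zero_isomorphic (x z : C) : is_zero x -> is_zero z -> isomorphic x z.
Proof.
move=> x0 z0; constructor; apply: (@Iso _ _ _ 0 0).
  by rewrite [LHS](x0 x).1 (iffLR (is_zeroP x) x0).
by rewrite [LHS](z0 z).1 (iffLR (is_zeroP z) z0).
Qed.

End Preadditive.

Lemma additive_zero (C D : preadditive) (F : functor C D) (z : C) :
  additive_functor F -> is_zero z -> is_zero (F z).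
Proof.
move=> FD z0; apply/is_zeroP; rewrite -fmap_id.
by rewrite (iffLR (is_zeroP z) z0) fmap0.
Qed.

Lemma fmapN (C D : preadditive) (F : functor C D) (x y : C) (f : hom x y) :
  additive_functor F -> fmap F (- f) = - fmap F f.
Proof.
by move=> FD; apply: (@addrI _ (fmap F f)); rewrite -FD !subrr fmap0.
Qed.

Section Triangles.
Variable T : triangulated.
Implicit Types x y z c : T.

Lemma shift_zero z : is_zero z -> is_zero (shift z).
Proof. exact/additive_zero/shift_additive. Qed.

Lemma shift_full x y (h : hom (shift x) (shift y)) : exists f, fmap shift f = h.
Proof.
by have [/(_ x y)[g _ gK] _] := shift_equiv T; exists (g h); exact: gK.
Qed.

Lemma shift_inj x y (f g : hom x y) : fmap shift f = fmap shift g -> f = g.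
Proof. by have [/(_ x y)/bij_inj H _] := shift_equiv T; exact: H. Qed.

Lemma shift_surj y : exists x, isomorphic (shift x) y.
Proof. by have [_] := shift_equiv T; exact. Qed.

Lemma shift_zero_inv z : is_zero (shift z) -> is_zero z.
Proof.
move=> /is_zeroP E; apply/is_zeroP; apply: shift_inj.
by rewrite fmap_id E fmap0//; exact: shift_additive.
Qed.

Lemma dist_isoz x y z z' (f : hom x y) (g : hom y z) (h : hom z (shift x))
    (c : iso z z') :
  dist f g h -> dist f (c ∘ g) (h ∘ bwd c).
Proof.
apply: (@dist_iso _ _ _ _ _ _ _ _ _ _ _ _ _ (iso_refl x) (iso_refl y) c) => /=.
- by rewrite comp1m compm1.
- by rewrite compm1.
- by rewrite -compA fwdK fmap_id compm1 comp1m.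
Qed.

Lemma dist0 x z : is_zero z -> dist (0 : hom z x) (idm x) (0 : hom x (shift z)).
Proof.
move=> z0; apply/dist_rotate; rewrite (fmap0 _ _ (@shift_additive T)) oppr0.
exact/dist_id/shift_zero.
Qed.

Section Exactness.
Variables (x y z : T) (f : hom x y) (g : hom y z) (h : hom z (shift x)).
Hypothesis D : dist f g h.

(** Fill the square formed by [k] and a zero map between the rotated triangles on [c] and on [f].
    The filler goes from [shift c] to [shift x], and its desuspension is the lift. *)
Lemma dist_kernel c (k : hom c y) : g ∘ k = 0 -> exists k', k = f ∘ k'.
Proof.
move=> gk; have [o o0] := zero_ex T.
have Dc := iffLR (dist_rotate _ _ _) (dist_id c o0).
have [|l [_]] := @dist_fill _ _ _ _ _ _ _ _ _ _ _ _ _ k 0 Dc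
  (iffLR (dist_rotate _ _ _) D); first by rewrite gk compm0.
have [k' <-] := shift_full l.
rewrite fmap_id compNr compm1 compNl -fmap_comp => /oppr_inj/shift_inj ->.
by exists k'.
Qed.

Lemma dist_cokernel c (k : hom y c) : k ∘ f = 0 -> exists k', k = k' ∘ g.
Proof.
move=> kf; have [o o0] := zero_ex T.
have [|k' [E _]] := @dist_fill _ _ _ _ _ _ _ _ _ _ _ _ _ 0 k D (dist0 c o0).
  by rewrite kf compm0.
by exists k'; rewrite E comp1m.
Qed.

Lemma dist_comp0 : g ∘ f = 0.
Proof.
have [o o0] := zero_ex T.
have [|k [E _]] := @dist_fill _ _ _ _ _ _ _ _ _ _ _ _ _ (idm x) f
  (dist_id x o0) D; first by rewrite !compm1.
by rewrite -E compm0.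
Qed.

End Exactness.

Lemma dist_comp0' x y z (f : hom x y) (g : hom y z) (h : hom z (shift x)) :
  dist f g h -> h ∘ g = 0.
Proof. by move=> /dist_rotate/dist_comp0. Qed.

Lemma dist_comp0'' x y z (f : hom x y) (g : hom y z) (h : hom z (shift x)) :
  dist f g h -> fmap shift f ∘ h = 0.
Proof.
by move=> /dist_rotate/dist_comp0'; rewrite compNl => /eqP; rewrite oppr_eq0 => /eqP.
Qed.

Lemma dist_kernel' x y z (f : hom x y) (g : hom y z) (h : hom z (shift x))
    c (k : hom c z) : dist f g h -> h ∘ k = 0 -> exists k', k = g ∘ k'.
Proof. by move=> /dist_rotate D /(dist_kernel D). Qed.

Lemma dist_cokernel' x y z (f : hom x y) (g : hom y z) (h : hom z (shift x))
    c (k : hom z c) : dist f g h -> k ∘ g = 0 -> exists k', k = k' ∘ h.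
Proof. by move=> /dist_rotate D /(dist_cokernel D). Qed.

Lemma dist_kernel'' x y z (f : hom x y) (g : hom y z) (h : hom z (shift x))
    c (k : hom c (shift x)) :
  dist f g h -> fmap shift f ∘ k = 0 -> exists k', k = h ∘ k'.
Proof.
move=> /dist_rotate/dist_rotate D E; apply: (dist_kernel D).
by rewrite compNl E oppr0.
Qed.

(** Exactness at [y] gives a right inverse; exactness at [shift x], after desuspension, gives a left
    inverse. *)
Lemma dist_iso_of_zero x y z (f : hom x y) (g : hom y z) (h : hom z (shift x)) :
  dist f g h -> is_zero z -> exists a : iso x y, a = f :> hom x y.
Proof.
move=> D z0; have [r rE] : exists r, idm y = f ∘ r.
  by apply: (dist_kernel D); rewrite compm1; exact: (z0 _).1.
have [s sE] : exists s, idm (shift x) = s ∘ (- fmap shift f).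
  apply: (dist_cokernel' (iffLR (dist_rotate _ _ _) D)).
  by rewrite comp1m; exact: (z0 _).2.
have [t tE] := shift_full s.
have {sE tE s} tf : idm x = (- t) ∘ f.
  apply: shift_inj; rewrite fmap_id fmap_comp sE -tE fmapN ?compNl ?compNr//.
  exact: shift_additive.
have tr : - t = r by rewrite -(compm1 (- t)) rE compA -tf comp1m.
by exists (Iso (etrans (congr1 (comp^~ f) (esym tr)) (esym tf)) (esym rE)).
Qed.

Lemma dist_iso0 x y z (a : iso x y) : is_zero z ->
  dist a (0 : hom y z) (0 : hom z (shift x)).
Proof.
move=> z0; apply: (@dist_iso _ _ _ _ _ _ _ _ _ _ _ _ _ (iso_refl x) a
  (iso_refl z) _ _ _ (dist_id x z0)) => //=.
- by rewrite compm0 comp0m.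
- by rewrite compm0 comp0m.
Qed.

(** Rotation turns each of the three closure properties into closure under cones, up to shifts. *)
Lemma triangulated_inI (S : set T) :
  (forall z, is_zero z -> S z) ->
  (forall x, S x <-> S (shift x)) ->
  (forall x y z (f : hom x y) (g : hom y z) (h : hom z (shift x)),
    dist f g h -> S x -> S y -> S z) ->
  triangulated_in setT S.
Proof.
move=> S0 Ss Sc; split=> // x y z f g h D _ _ _; split.
- exact: Sc D.
- by move=> Sy Sz; apply/Ss; move/dist_rotate: D => /Sc; exact.
- move=> /Ss Sx Sz; apply/Ss.
  by move/dist_rotate: D => /dist_rotate/Sc; exact.
Qed.

Section TriangulatedIn.
Variables (D S : set T).
Hypothesis tS : triangulated_in D S.

Lemma tri_iso x y : (forall z, is_zero z -> D z) -> D y -> 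
  isomorphic x y -> S x -> S y.
Proof.
move=> D0 Dy [a] Sx; have [o o0] := zero_ex T.
have [_ _ H] := tri_two_of_three tS (dist_iso0 a o0) (tri_sub tS Sx) Dy (D0 _ o0).
by apply: H Sx (tri_zero tS o0).
Qed.

Lemma tri_shift x : (forall z, is_zero z -> D z) -> D x -> D (shift x) ->
  S x <-> S (shift x).
Proof.
move=> D0 Dx Dsx; have [o o0] := zero_ex T.
have DD := iffLR (dist_rotate _ _ _) (dist_id x o0).
have [H1 H2 H3] := tri_two_of_three tS DD Dx (D0 _ o0) Dsx.
by have So := tri_zero tS o0; split=> H; [exact: H1|exact: H2].
Qed.

End TriangulatedIn.

Section LocIso.
Variable S : set T.
Hypothesis tS : triangulated_in setT S.

Lemma triT_iso x y : isomorphic x y -> S x -> S y.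
Proof. exact: (tri_iso tS). Qed.

Lemma triT_shift x : S x <-> S (shift x).
Proof. exact: (tri_shift tS). Qed.

Lemma triT_cone x y z (f : hom x y) (g : hom y z) (h : hom z (shift x)) :
  dist f g h -> S x -> S y -> S z.
Proof. by move=> D; have [H _ _] := tri_two_of_three tS D I I I. Qed.

End LocIso.

End Triangles.

Lemma exact_comp (C D E : triangulated) (G : functor D E) (F : functor C D) :
  exact_functor G -> exact_functor F -> exact_functor (comp_functor G F).
Proof.
move=> [GD [s [sN sd]]] [FD [t [tN td]]]; split.
  by move=> x y f g /=; rewrite FD GD.
exists (fun x => iso_trans (fmap_iso G (t x)) (s (F x))); split=> [x y f|x y z f g h].
  rewrite /= -compA -fmap_comp tN fmap_comp compA sN.
  by rewrite -[LHS]compA.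
by move=> /td/sd; rewrite fmap_comp compA.
Qed.

Section ExactFunctor.
Variables (C D : triangulated) (F : functor C D).
Hypothesis FE : exact_functor F.

Lemma exact_additive : additive_functor F.
Proof. by have [] := FE. Qed.

Lemma exact_zero z : is_zero z -> is_zero (F z).
Proof. exact/additive_zero/exact_additive. Qed.

Lemma exact_dist (x y z : C) (f : hom x y) (g : hom y z) (h : hom z (shift x)) :
  dist f g h -> exists h', dist (fmap F f) (fmap F g) h'.
Proof. by have [_ [s [_ sd]]] := FE => /sd; exists (s x ∘ fmap F h). Qed.

Lemma exact_shift (x : C) : isomorphic (F (shift x)) (shift (F x)).
Proof. by have [_ [s _]] := FE; constructor; exact: s. Qed.

(** The ambient classes are kept as parameters because thick ideals are triangulated only inside the
    compact objects. *)
Lemma triangulated_preimage (S : set D) (P : set D) (P' : set C) :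
  (forall x, P' x -> P (F x)) -> (forall z, is_zero z -> P' z) ->
  triangulated_in P S -> triangulated_in P' [set x | P' x /\ S (F x)].
Proof.
move=> PP P0 tS; split=> [x []//|z z0|x y z u v w /exact_dist[w' D'] cx cy cz].
  by split; [exact: P0|exact/(tri_zero tS)/exact_zero].
have [H1 H2 H3] := tri_two_of_three tS D' (PP _ cx) (PP _ cy) (PP _ cz).
by split=> -[_ q1] [_ q2]; split=> //; [exact: H1|exact: H2|exact: H3].
Qed.

End ExactFunctor.

(** * Coproducts and compact objects *)

Lemma inj_surj_bij (A B : Type) (f : A -> B) :
  injective f -> (forall y, exists x, f x = y) -> bijective f.
Proof.
move=> fi /choice[g gK]; exists g => // x; exact: fi.
Qed.

Lemma bij_surj (A B : Type) (f : A -> B) :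
  bijective f -> forall y, exists x, f x = y.
Proof. by move=> [g _ gK] y; exists (g y); exact: gK. Qed.

Section Coproducts.
Variable C : preadditive.

Lemma coproduct_hom_eq (I : small) (X : I -> C) (c : C)
    (j : forall i, hom (X i) c) (y : C) (h h' : hom c y) :
  is_coproduct j -> (forall i, h ∘ j i = h' ∘ j i) -> h = h'.
Proof.
by move=> /(_ y (fun i => h' ∘ j i))[k [_ kU]] E; rewrite -(kU h E) -(kU h').
Qed.

Lemma coproduct_iso (I : small) (X : I -> C) (c d : C)
    (j : forall i, hom (X i) c) (k : forall i, hom (X i) d) :
  is_coproduct j -> is_coproduct k ->
  exists a : iso c d, forall i, a ∘ j i = k i.
Proof.
move=> jP kP; have [a [aE _]] := jP _ k; have [b [bE _]] := kP _ j.
have ba : b ∘ a = idm c.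
  by apply: (coproduct_hom_eq jP) => i; rewrite -compA aE bE comp1m.
have ab : a ∘ b = idm d.
  by apply: (coproduct_hom_eq kP) => i; rewrite -compA bE aE comp1m.
by exists (Iso ba ab).
Qed.

Lemma coproduct_isol (I : small) (X X' : I -> C) (c : C)
    (j : forall i, hom (X i) c) (a : forall i, iso (X' i) (X i)) :
  is_coproduct j -> is_coproduct (fun i => j i ∘ a i).
Proof.
move=> jP y f; have [h [hE hU]] := jP y (fun i => f i ∘ bwd (a i)).
exists h; split=> [i|k kE]; first by rewrite compA hE -compA fwdK compm1.
by apply: hU => i; rewrite -kE -!compA bwdK compm1.
Qed.

Lemma coproduct_proj (I : small) (X : I -> C) (c : C)
    (j : forall i, hom (X i) c) : is_coproduct j ->
  exists p : forall i, hom c (X i),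
    (forall i, p i ∘ j i = idm (X i)) /\ (forall i k, i <> k -> p i ∘ j k = 0).
Proof.
move=> jP.
(* The Kronecker delta. The identity has to be transported along [k = i], since [X k] and [X i] are
   different objects until the equality is eliminated. *)
pose d i k : hom (X k) (X i) :=
  if pselect (k = i) is left e
  then match e in _ = l return hom (X k) (X l) with erefl => idm (X k) end
  else 0.
have /all_tag[p pE] i : {p : hom c (X i) | forall k, p ∘ j k = d i k}.
  by apply: cid; have [h [hE _]] := jP _ (d i); exists h.
exists p; split=> [i|i k ik]; rewrite pE /d; case: pselect => // e.
  by rewrite (Prop_irrelevance e erefl).
by case: ik.
Qed.

Section FiniteSupport.
Variables (I : small) (X : I -> C) (d : C) (j : forall i, hom (X i) d).

(** Each entry carries its own map, so an index may occur with several maps and sums are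
    concatenations. In [compact_ob] a single family of maps serves the whole list. *)
Definition fin_supp (c : C) (f : hom c d) : Prop :=
  exists s : seq {i & hom c (X i)}, f = \sum_(w <- s) (j (tag w) ∘ tagged w).

Lemma fin_supp0 c : fin_supp (0 : hom c d).
Proof. by exists [::]; rewrite big_nil. Qed.

Lemma fin_supp1 c i (u : hom c (X i)) : fin_supp (j i ∘ u).
Proof. by exists [:: Tagged (fun i => hom c (X i)) u]; rewrite big_seq1. Qed.

Lemma fin_suppD c (f f' : hom c d) : fin_supp f -> fin_supp f' -> fin_supp (f + f').
Proof. by move=> [s ->] [s' ->]; exists (s ++ s'); rewrite big_cat. Qed.

Lemma fin_supp_sum c (J : Type) (s : seq J) (f : J -> hom c d) :
  (forall k, fin_supp (f k)) -> fin_supp (\sum_(k <- s) f k).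
Proof.
move=> fP; elim: s => [|k s IH]; first by rewrite big_nil; exact: fin_supp0.
by rewrite big_cons; exact: fin_suppD.
Qed.

Lemma fin_supp_comp c c' (f : hom c d) (u : hom c' c) :
  fin_supp f -> fin_supp (f ∘ u).
Proof.
move=> [s ->]; rewrite comp_suml; apply: fin_supp_sum => w.
by rewrite -compA; exact: fin_supp1.
Qed.

(** Entries with the same index are collected into the component [p i ∘ f], so a map of finite
    support is zero once its components are. [{classic I}] supplies the decidable equality for
    [undup]. *)
Lemma fin_supp_proj (p : forall i, hom d (X i)) c (f : hom c d) :
  (forall i, p i ∘ j i = idm (X i)) -> (forall i k, i <> k -> p i ∘ j k = 0) ->
  fin_supp f ->
  exists s : seq {classic I}, uniq s /\ f = \sum_(i <- s) (j i ∘ (p i ∘ f)).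
Proof.
move=> p1 p0 [s0 fE]; pose s : seq {classic {i & hom c (X i)}} := s0.
have {}fE : f = \sum_(w <- s) (j (tag w) ∘ tagged w) by [].
pose t : seq {classic I} := undup [seq (tag w : {classic I}) | w <- s].
exists t; split; first exact: undup_uniq.
transitivity (\sum_(i <- t) \sum_(w <- s) (j i ∘ (p i ∘ (j (tag w) ∘ tagged w)))).
  rewrite exchange_big/= {1}fE; apply: eq_big_seq => w ws.
  rewrite (bigD1_seq (tag w : {classic I}))/= ?undup_uniq//; last first.
    rewrite mem_undup.
    exact: (map_f (fun w : {classic {i & hom c (X i)}} => tag w : {classic I}) ws).
  rewrite [p _ ∘ _]compA p1 comp1m big1 ?addr0// => i /eqP iw.
  by rewrite [p _ ∘ _]compA p0// comp0m compm0.
by apply: eq_bigr => i _; rewrite fE !comp_sumr.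
Qed.

End FiniteSupport.

Section Compact.
Variable S : has_coproducts C.

Lemma compactP (c : C) : compact_ob S c <->
  forall (I : small) (X : I -> C) (f : hom c (coprod S X)), fin_supp (inj S X) f.
Proof.
split=> H I X f.
  by have [s [g ->]] := H I X f; apply: fin_supp_sum => i; exact: fin_supp1.
have [p [p1 p0]] := coproduct_proj (coprodP S X).
have [s [_ E]] := fin_supp_proj p1 p0 (H I X f).
by exists s, (fun i => p i ∘ f).
Qed.

Lemma compact_coproduct (c : C) (I : small) (X : I -> C) (d : C)
    (j : forall i, hom (X i) d) (f : hom c d) :
  compact_ob S c -> is_coproduct j -> fin_supp j f.
Proof.
move=> /compactP cc jP; have [a aE] := coproduct_iso (coprodP S X) jP.
have [s sE] := cc I X (bwd a ∘ f); exists s.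
by rewrite -[LHS](isoKV a) sE comp_sumr; apply: eq_bigr => w _; rewrite compA aE.
Qed.

Lemma compact_iso (c c' : C) :
  isomorphic c c' -> compact_ob S c -> compact_ob S c'.
Proof.
move=> [a] /compactP cc; apply/compactP => I X f.
by rewrite -(compm1 f) -(bwdK a) compA; apply: fin_supp_comp.
Qed.

Lemma compact_biproduct (x y b : C) :
  is_biproduct x y b -> compact_ob S x -> compact_ob S y -> compact_ob S b.
Proof.
move=> [i [j [p [q [_ _ _ _ E]]]]] /compactP cx /compactP cy; apply/compactP => I X f.
rewrite -(compm1 f) -E compDr !compA; apply: fin_suppD; exact: fin_supp_comp.
Qed.

End Compact.

End Coproducts.

(** For compact [c] and [c'] both hom groups are direct sums over [I], and [t] is the direct sum of
    the [ti]. *)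
Lemma coproduct_bij (C D : preadditive) (S : has_coproducts C)
    (S' : has_coproducts D) (I : small)
    (X : I -> C) (d : C) (j : forall i, hom (X i) d)
    (Y : I -> D) (d' : D) (j' : forall i, hom (Y i) d') (c : C) (c' : D)
    (t : hom c d -> hom c' d') (ti : forall i, hom c (X i) -> hom c' (Y i)) :
  compact_ob S c -> compact_ob S' c' -> is_coproduct j -> is_coproduct j' ->
  (forall u v, t (u + v) = t u + t v) ->
  (forall i u, t (j i ∘ u) = j' i ∘ ti i u) ->
  (forall i, bijective (ti i)) -> bijective t.
Proof.
move=> cc cc' jP jP' tD tj tib.
have [p [p1 p0]] := coproduct_proj jP; have [q [q1 q0]] := coproduct_proj jP'.
have t0 : t 0 = 0 by apply: (@addrI _ (t 0)); rewrite -tD !addr0.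
have tS (J : Type) (s : seq J) (f : J -> hom c d) :
    t (\sum_(i <- s) f i) = \sum_(i <- s) t (f i).
  by elim: s => [|i s IH]; rewrite ?big_nil// !big_cons tD IH.
have tqE i u : ti i u = q i ∘ t (j i ∘ u) by rewrite tj compA q1 comp1m.
have ti0 i : ti i 0 = 0 by rewrite tqE compm0 t0 compm0.
have tN u : t (- u) = - t u by apply: (@addrI _ (t u)); rewrite -tD !subrr.
apply: inj_surj_bij => [u v E|w].
  apply/eqP; rewrite -subr_eq0; apply/eqP.
  have {}E : t (u - v) = 0 by rewrite tD tN E subrr.
  move: (u - v) E => {u v} u tu.
  have [s [us uE]] := fin_supp_proj p1 p0 (compact_coproduct u cc jP).
  rewrite uE big_seq big1// => i si.
  suff -> : p i ∘ u = 0 by rewrite compm0.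
  apply: (bij_inj (tib i)); rewrite ti0.
  move: tu; rewrite {1}uE tS => /(congr1 (comp (q i))).
  rewrite compm0 comp_sumr (bigD1_seq i)//= tj compA q1 comp1m.
  rewrite big1 ?addr0// => k /eqP ki.
  by rewrite tj compA q0 ?comp0m//; apply/nesym.
have [s [us wE]] := fin_supp_proj q1 q0 (compact_coproduct w cc' jP').
have /all_tag[v vE] i : {v | ti i v = q i ∘ w} by apply/cid/bij_surj.
exists (\sum_(i <- s) (j i ∘ v i)); rewrite wE tS.
by apply: eq_bigr => i _; rewrite tj vE.
Qed.

Section TriangulatedCompact.
Variables (T : triangulated) (S : has_coproducts T).

Lemma shift_coproducts : preserves_coproducts (@shift T).
Proof.
move=> I X c j jP y f; have [y' [a]] := shift_surj y.
have /all_tag[f' f'E] i : {f' | fmap shift f' = bwd a ∘ f i}.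
  exact/cid/shift_full.
have [h [hE hU]] := jP _ f'; exists (a ∘ fmap shift h); split=> [i|k kE].
  by rewrite -compA -fmap_comp hE f'E isoKV.
have [k' k'E] := shift_full (bwd a ∘ k).
rewrite -[RHS](isoKV a) -k'E; congr (_ ∘ fmap _ _); apply: hU => i.
by apply: shift_inj; rewrite fmap_comp k'E f'E -compA kE.
Qed.

Lemma compact_shift (c : T) : compact_ob S c <-> compact_ob S (shift c).
Proof.
split=> /compactP cc; apply/compactP => I X f.
  have /choice[X' aa] : forall i, exists x, isomorphic (shift x) (X i).
    by move=> i; exact: shift_surj.
  pose a i := iso_sym (iso_of (aa i)).
  have kP := coproduct_isol a (shift_coproducts (coprodP S X')).
  have [b bE] := coproduct_iso (coprodP S X) kP.
  have [f' f'E] := shift_full (b ∘ f).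
  have [s sE] := cc _ _ f'.
  rewrite -[f](isoK b) -f'E sE fmap_sum; last exact: shift_additive.
  rewrite comp_sumr; apply: fin_supp_sum => w.
  rewrite fmap_comp -[fmap shift (tagged w)](isoKV (a (tag w))).
  rewrite [fmap shift (inj _ _ _) ∘ _]compA -bE -compA isoK.
  exact: fin_supp1.
have [s sE] : fin_supp (fun i => fmap shift (inj S X i)) (fmap shift f).
  by apply: (@compact_coproduct _ S); [exact/compactP|exact/shift_coproducts/coprodP].
have /all_tag[g gE] (w : {i & hom (shift c) (shift (X i))}) :
    {g | fmap shift g = tagged w} by exact/cid/shift_full.
suff -> : f = \sum_(w <- s) (inj S X (tag w) ∘ g w).
  by apply: fin_supp_sum => w; exact: fin_supp1.
apply: shift_inj; rewrite sE fmap_sum; last exact: shift_additive.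
by apply: eq_bigr => w _; rewrite fmap_comp gE.
Qed.

(** Subtracting a finite sum from a map out of [z] makes it vanish on [y]. What remains factors
    through the compact object [shift x]. *)
Lemma compact_cone (x y z : T) (f : hom x y) (g : hom y z) (h : hom z (shift x)) :
  dist f g h -> compact_ob S x -> compact_ob S y -> compact_ob S z.
Proof.
move=> D /compact_shift/compactP cx /compactP cy; apply/compactP => I X k.
have [p [p1 p0]] := coproduct_proj (coprodP S X).
have [s [us sE]] := fin_supp_proj p1 p0 (cy I X (k ∘ g)).
have /all_tag[v vE] i : {v | p i ∘ (k ∘ g) = v ∘ g}.
  apply/cid/(dist_cokernel D).
  by rewrite -!compA (dist_comp0 D) !compm0.
have [|l lE] := dist_cokernel' (k := k - \sum_(i <- s) (inj S X i ∘ v i)) D.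
  rewrite compDl compNl {1}sE comp_suml; apply/eqP; rewrite subr_eq0; apply/eqP.
  by apply: eq_bigr => i _; rewrite -compA vE.
rewrite -[k](subrK (\sum_(i <- s) (inj S X i ∘ v i))) lE.
apply: fin_suppD; first exact: fin_supp_comp.
by apply: fin_supp_sum => i; exact: fin_supp1.
Qed.

Lemma compact_zero (z : T) : is_zero z -> compact_ob S z.
Proof.
move=> z0; apply/compactP => I X f; have -> : f = 0 by exact: (z0 _).2.
exact: fin_supp0.
Qed.

End TriangulatedCompact.

(** The comparison maps are arbitrary functions because in the main application they have the form
    [u => k ∘ fmap f u] and land in another category. *)
Lemma five_hom (C D : triangulated) (x y z : C) (x' y' z' : D)
    (f : hom x y) (g : hom y z) (h : hom z (shift x))
    (f' : hom x' y') (g' : hom y' z') (h' : hom z' (shift x')) (c : C) (c' : D)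
    (tx : hom c x -> hom c' x') (ty : hom c y -> hom c' y')
    (tz : hom c z -> hom c' z') (tsx : hom c (shift x) -> hom c' (shift x'))
    (tsy : hom c (shift y) -> hom c' (shift y')) :
  dist f g h -> dist f' g' h' ->
  (forall u, ty (f ∘ u) = f' ∘ tx u) -> (forall u, tz (g ∘ u) = g' ∘ ty u) ->
  (forall u, tsx (h ∘ u) = h' ∘ tz u) ->
  (forall u, tsy (fmap shift f ∘ u) = fmap shift f' ∘ tsx u) ->
  (forall u v, tz (u + v) = tz u + tz v) ->
  tsx 0 = 0 -> tsy 0 = 0 ->
  bijective tx -> bijective ty -> bijective tsx -> bijective tsy ->
  bijective tz.
Proof.
move=> D1 D2 Exy Eyz Ezx Esxy tzD tsx0 tsy0 bx by_ bsx bsy.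
have tz0 : tz 0 = 0 by apply: (@addrI _ (tz 0)); rewrite -tzD !addr0.
have tzN u : tz (- u) = - tz u by apply: (@addrI _ (tz u)); rewrite -tzD !subrr.
apply: inj_surj_bij => [u v E|w].
  apply/eqP; rewrite -subr_eq0; apply/eqP.
  have {}E : tz (u - v) = 0 by rewrite tzD tzN E subrr.
  move: (u - v) E => {u v} u tu.
  have hu : h ∘ u = 0 by apply: (bij_inj bsx); rewrite Ezx tu compm0 tsx0.
  have [v vE] := dist_kernel' D1 hu.
  move: tu; rewrite vE Eyz => /(dist_kernel D2)[w wE].
  have [k kE] := bij_surj bx w.
  suff -> : v = f ∘ k by rewrite compA (dist_comp0 D1) comp0m.
  by apply: (bij_inj by_); rewrite Exy kE.
have [k kE] := bij_surj bsx (h' ∘ w).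
have fk : fmap shift f ∘ k = 0.
  by apply: (bij_inj bsy); rewrite Esxy kE compA (dist_comp0'' D2) comp0m tsy0.
have [u uE] := dist_kernel'' D1 fk.
have [|v vE] := dist_kernel' (k := w - tz u) D2.
  by rewrite compDr compNr -Ezx -uE kE subrr.
have [l lE] := bij_surj by_ v.
by exists (u + g ∘ l); rewrite tzD Eyz lE -vE addrC subrK.
Qed.

(** * Localizing subcategories and cellular approximation *)

Section Localizing.
Variables (T : triangulated) (S : has_coproducts T).

Lemma loc_iso (L : set T) x y : localizing S L -> isomorphic x y -> L x -> L y.
Proof. by move=> [tL _]; exact: triT_iso. Qed.

Lemma loc_zero (L : set T) z : localizing S L -> is_zero z -> L z.
Proof. by move=> [tL _]; exact: tri_zero tL _. Qed.

Lemma loc_shift (L : set T) x : localizing S L -> L x <-> L (shift x).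
Proof. by move=> [tL _]; exact: triT_shift. Qed.

Lemma loc_cone (L : set T) x y z (f : hom x y) (g : hom y z) (h : hom z (shift x)) :
  localizing S L -> dist f g h -> L x -> L y -> L z.
Proof. by move=> [tL _]; exact: triT_cone. Qed.

Lemma loc_coproduct (L : set T) (I : small) (X : I -> T) (d : T)
    (j : forall i, hom (X i) d) :
  localizing S L -> is_coproduct j -> (forall i, L (X i)) -> L d.
Proof.
move=> lL jP XL; have [a _] := coproduct_iso (coprodP S X) jP.
by apply: (loc_iso lL) (loc_coprod lL XL); constructor.
Qed.

Lemma localizing_is_zero : localizing S (@is_zero T).
Proof.
split.
  apply: triangulated_inI => // [x|x y z f g h D x0 y0].
    by split; [exact: shift_zero|exact: shift_zero_inv].
  apply/is_zeroP; have [|k ->] := dist_cokernel' (k := idm z) D.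
    by rewrite comp1m; exact: (y0 _).2.
  by rewrite [k](shift_zero x0 _).2 comp0m.
move=> I X X0; apply/is_zeroP; apply: (coproduct_hom_eq (coprodP S X)) => i.
by rewrite comp0m; exact: (X0 i _).2.
Qed.

Definition shift_stable (A : set T) : Prop :=
  (forall c, A c -> A (shift c)) /\
  (forall c, A c -> exists c', A c' /\ isomorphic (shift c') c).

Definition right_perp (A : set T) : set T :=
  [set w | forall c, A c -> forall h : hom c w, h = 0].

Definition left_perp (W : set T) : set T :=
  [set x | forall w, W w -> forall h : hom x w, h = 0].

Lemma hom_iso_zero (x y z : T) (a : isomorphic x y) :
  (forall h : hom x z, h = 0) -> forall h : hom y z, h = 0.
Proof.
by case: a => a H h; rewrite -(compm1 h) -(bwdK a) compA (H (h ∘ a)) comp0m.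
Qed.

Lemma right_perp_shift_stable (A : set T) :
  shift_stable A -> shift_stable (right_perp A).
Proof.
move=> [As Ad]; split=> w wA; last first.
  have [w' [a]] := shift_surj w; exists w'; split=> // c /As Ac h.
  apply: shift_inj; rewrite (fmap0 _ _ (@shift_additive T)).
  by rewrite -[LHS](isoK a) (wA _ Ac (a ∘ _)) compm0.
move=> c /Ad[c' [Ac' a]]; apply: hom_iso_zero a _ => h.
by have [h' <-] := shift_full h; rewrite (wA _ Ac' h') (fmap0 _ _ (@shift_additive T)).
Qed.

(** Shifting the source of a map amounts to desuspending its target, hence the stability of [W] in
    both directions. *)
Lemma left_perp_localizing (W : set T) :
  shift_stable W -> localizing S (left_perp W).
Proof.
move=> [Ws Wd]; split; first apply: triangulated_inI.
- by move=> z z0 w _ h; exact: (z0 _).2.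
- move=> x; split=> H w Ww h.
    have [w' [Ww' [a]]] := Wd w Ww; have [h' h'E] := shift_full (bwd a ∘ h).
    rewrite -[h](isoKV a) -h'E (H _ Ww' h') (fmap0 _ _ (@shift_additive T)).
    by rewrite compm0.
  by apply: shift_inj; rewrite (H _ (Ws _ Ww) (fmap shift h)) (fmap0 _ _ (@shift_additive T)).
- move=> x y z f g h D xW yW w Ww k.
  have [k' ->] := dist_cokernel' (k := k) D (yW _ Ww _).
  suff -> : k' = 0 by rewrite comp0m.
  have [w' [Ww' [a]]] := Wd w Ww; have [h' h'E] := shift_full (bwd a ∘ k').
  rewrite -[k'](isoKV a) -h'E (xW _ Ww' h') (fmap0 _ _ (@shift_additive T)).
  by rewrite compm0.
- move=> I X XL w Ww h; apply: (coproduct_hom_eq (coprodP S X)) => i.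
  by rewrite comp0m; exact: XL.
Qed.

(** The left orthogonal of [right_perp A] is localizing and contains [A], hence [w]. As [w] also
    lies in [right_perp A], its identity vanishes. *)
Lemma generators_detect (A : set T) (w : T) : shift_stable A ->
  (forall L, localizing S L -> A `<=` L -> L w) -> right_perp A w -> is_zero w.
Proof.
move=> As Ag wA; apply/is_zeroP.
have := Ag _ (left_perp_localizing (right_perp_shift_stable As)); apply=> //.
by move=> c Ac v; exact.
Qed.

Lemma compact_shift_stable : shift_stable (compact_ob S).
Proof.
split=> [c|c cc]; first by move=> /compact_shift.
have [c' a] := shift_surj c; exists c'; split=> //.
by apply/compact_shift; exact: compact_iso (isomorphic_sym a) cc.
Qed.

Lemma dist_fiber (y z : T) (p : hom y z) :
  exists (x : T) (i : hom x y) (h : hom z (shift x)), dist i p h.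
Proof.
have [w [g [h D]]] := dist_cone p; have [x /isomorphic_sym[a]] := shift_surj w.
have [i iE] := shift_full (- (h ∘ bwd a)).
exists x, i, (a ∘ g); apply/dist_rotate.
by rewrite iE opprK; exact: dist_isoz.
Qed.

End Localizing.

Lemma localizing_preimage (C D : triangulated) (SC : has_coproducts C)
    (SD : has_coproducts D) (F : functor C D) (L : set D) :
  exact_functor F -> preserves_coproducts F -> localizing SD L ->
  localizing SC [set x | L (F x)].
Proof.
move=> FE FP lL; split=> [|I X XL]; last first.
  by apply: (loc_coproduct lL (FP _ _ _ _ (coprodP SC X))).
apply: triangulated_inI => /= [z z0|x|x y z f g h D'].
- exact/(loc_zero lL)/(exact_zero FE).
- rewrite (loc_shift (F x) lL); split; apply: (loc_iso lL).
    exact/isomorphic_sym/exact_shift.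
  exact: exact_shift.
- by have [h'] := exact_dist FE D'; exact: loc_cone lL.
Qed.

Section Telescope.
Variables (T : triangulated) (S : has_coproducts T).
Variables (X : nat -> T) (t : forall n, hom (X n) (X n.+1)).

(** The homotopy colimit, that is, the cone of [idm c - sh] on the coproduct [c], where [sh] moves
    each summand to the next along [t]. Its universal property is weak: the map [q] need not be
    unique. *)
Lemma telescope : exists (e : T) (j : forall n, hom (X n) e),
  [/\ forall n, j n.+1 ∘ t n = j n,
      forall L, localizing S L -> (forall n, L (X n)) -> L e,
      forall (x : T) (p : forall n, hom (X n) x),
        (forall n, p n.+1 ∘ t n = p n) -> exists q, forall n, q ∘ j n = p n
    & forall (c : T) (u : hom c e), compact_ob S c ->
        exists n (v : hom c (X n)), u = j n ∘ v].
Proof.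
pose c := coprod S X; pose i := inj S X.
have iP : is_coproduct i by exact: coprodP.
have [sh [shE _]] := iP c (fun n => i n.+1 ∘ t n).
pose d := idm c - sh.
have [e [q [r D]]] := dist_cone d.
have qd : q ∘ sh = q.
  by have /eqP := dist_comp0 D; rewrite compDr compNr compm1 subr_eq0 => /eqP.
exists e, (fun n => q ∘ i n).
have jt n : q ∘ i n.+1 ∘ t n = q ∘ i n by rewrite -compA -shE compA qd.
split=> //.
- move=> L lL XL; have Lc : L c by apply: loc_coprod.
  exact: (loc_cone lL D).
- move=> x p pt; have [h [hE _]] := iP x p.
  have [|k kE] := dist_cokernel (k := h) D.
    rewrite compDr compNr compm1; apply/eqP; rewrite subr_eq0; apply/eqP.
    by apply: (coproduct_hom_eq iP) => n; rewrite -compA shE compA !hE.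
  by exists k => n; rewrite compA -kE.
move=> a u ca.
have [p [p1 p0]] := coproduct_proj iP.
have psh0 : p 0%N ∘ sh = 0.
  by apply: (coproduct_hom_eq iP) => n; rewrite -compA shE compA p0// !comp0m.
have pshS n : p n.+1 ∘ sh = t n ∘ p n.
  apply: (coproduct_hom_eq iP) => m; rewrite -!compA shE compA.
  have [->|nm] := eqVneq n m; first by rewrite !p1 comp1m compm1.
  rewrite !p0 ?comp0m ?compm0//; first exact/eqP.
  by move=> [] /eqP; apply/negP.
(* The desuspension [v] of this composite is fixed by [sh]. Since [sh] moves component [n] to
   component [n.+1] and reaches nothing in component 0, all components of [v] vanish by induction;
   finite support then gives [v = 0]. *)
have ru : r ∘ u = 0.
  have [a' [b]] := shift_surj a.
  have ca' : compact_ob S a'.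
    apply/compact_shift; apply: compact_iso ca; constructor; exact: iso_sym b.
  have [v vE] := shift_full (r ∘ u ∘ b).
  apply: (@iso_injr _ _ _ _ b); rewrite comp0m -vE.
  have dv : d ∘ v = 0.
    apply: shift_inj; rewrite fmap_comp vE !compA (dist_comp0'' D) !comp0m.
    by rewrite fmap0//; exact: shift_additive.
  have shv : sh ∘ v = v.
    by move/eqP: dv; rewrite compDl comp1m compNl subr_eq0 => /eqP.
  have pv n : p n ∘ v = 0.
    elim: n => [|n IH]; rewrite -{1}shv compA ?psh0 ?comp0m//.
    by rewrite pshS -compA IH compm0.
  have [s [_ ->]] := fin_supp_proj p1 p0 (compact_coproduct v ca' iP).
  rewrite big1 ?fmap0//; first exact: shift_additive.
  by move=> n _; rewrite pv compm0.
have [v ->] := dist_kernel' D ru.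
(* The finitely many summands of a lift to the coproduct are pushed to a common stage. *)
have jle n m : (n <= m)%N -> exists t', q ∘ i n = q ∘ i m ∘ t'.
  move=> /subnK <-; elim: (m - n)%N => [|k [t' IH]].
    by exists (idm _); rewrite compm1.
  by exists (t (k + n)%N ∘ t'); rewrite IH compA jt.
have [s ->] := compact_coproduct v ca iP.
elim: s => [|w s [n [v' E]]].
  by exists 0%N, 0; rewrite big_nil !compm0.
have [t1 E1] := jle _ _ (leq_maxl (tag w) n).
have [t2 E2] := jle _ _ (leq_maxr (tag w) n).
exists (maxn (tag w) n), (t1 ∘ tagged w + t2 ∘ v').
by rewrite big_cons !compDr E compA E1 E2 !compA.
Qed.

End Telescope.

Section Cellular.
Variables (T : triangulated) (S : has_coproducts T) (K : small) (C : K -> T).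
Hypothesis C_compact : forall k, compact_ob S (C k).

(* [e -> x] is obtained by attaching cells [C k] so as to make every map
   [C k -> x] lift uniquely. *)
Lemma cellular (x : T) : exists (X : nat -> T) (e : T)
    (j : forall n, hom (X n) e) (p : hom e x),
  [/\ forall F : set T, (forall (I : small) (n : I -> K), F (coprod S (C \o n))) ->
        (forall a b z (f : hom a b) (g : hom b z) (h : hom z (shift a)),
          dist f g h -> F a -> F b -> F z) -> forall n, F (X n),
      forall L, localizing S L -> (forall k, L (C k)) -> L e,
      forall (c : T) (u : hom c e), compact_ob S c ->
        exists n (v : hom c (X n)), u = j n ∘ v,
      forall k (u : hom (C k) x), exists v, u = p ∘ v
    & forall k (v : hom (C k) e), p ∘ v = 0 -> v = 0].
Proof.
pose st := {E : T & hom E x}.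
pose R (s s' : st) := exists t : hom (tag s) (tag s'),
  [/\ tagged s' ∘ t = tagged s,
      forall k (u : hom (C k) (tag s)), tagged s ∘ u = 0 -> t ∘ u = 0
    & exists (I : small) (n : I -> K) (a : hom (coprod S (C \o n)) (tag s)) b,
        dist a t b].
have /choice[next nextP] : forall s, exists s', R s s'.
  move=> [E p]; have [y [i [h D]]] := dist_fiber p.
  (* One cell for each map from some [C k] to the fibre [y] of [p]. A map [C k -> E] killed by [p]
     comes from such a map, so it dies in the cone. *)
  pose I := {k : K & hom (C k) y}; pose n (w : I) := tag w.
  have [a [aE _]] := coprodP S (C \o n) (fun w => tagged w).
  have [E' [t [b D']]] := dist_cone (i ∘ a).
  have [|p' p'E] := dist_cokernel (k := p) D'.
    by rewrite compA (dist_comp0 D) comp0m.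
  exists (Tagged (fun E => hom E x) p'), t; split=> /=.
  - by rewrite -p'E.
  - move=> k u /(dist_kernel D)[v ->].
    have -> : v = a ∘ inj S (C \o n) (Tagged (fun k => hom (C k) y) v) by rewrite aE.
    by rewrite 2!compA -(compA t) (dist_comp0 D') comp0m.
  - by exists I, n, (i ∘ a), b.
pose I0 := {k : K & hom (C k) x}; pose n0 (w : I0) := tag w.
have [a0 [a0E _]] := coprodP S (C \o n0) (fun w => tagged w).
pose s n := iter n next (Tagged (fun E => hom E x) a0).
have /all_tag[t tP] n := cid (nextP (s n)).
have [e [j [jt jL jx jc]]] := telescope S t.
have [|p pE] := jx x (fun n => tagged (s n)); first by move=> n; case: (tP n).
exists (fun n => tag (s n)), e, j, p.
(* Besides localizing classes, [F] will be [factors_fin], for which only coproducts of cells and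
   cones are available. *)
have FX (F : set T) : (forall (I : small) (n : I -> K), F (coprod S (C \o n))) ->
    (forall a b z (f : hom a b) (g : hom b z) (h : hom z (shift a)),
      dist f g h -> F a -> F b -> F z) -> forall n, F (tag (s n)).
  move=> F0 Fc; elim=> [|n IH]; first exact: F0.
  have [_ _ [I [m [a [b D]]]]] := tP n.
  exact: Fc D (F0 _ _) IH.
split=> //.
- move=> L lL CL; apply: (jL _ lL); apply: FX => [I n|a b z f g h D].
    by apply: (loc_coprod lL) => w; exact: CL.
  exact: loc_cone lL D.
- move=> k u; exists (j 0%N ∘ inj S (C \o n0) (Tagged (fun k => hom (C k) x) u)).
  by rewrite compA pE; exact: esym (a0E (Tagged (fun k => hom (C k) x) u)).
- move=> k v pv; have [n [w wE]] := jc _ v (@C_compact k).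
  have [_ H _] := tP n; rewrite wE -jt -compA H ?compm0//.
  by rewrite -pE -compA -wE.
Qed.

(** The boundary of a map from a cell to [f] is, up to shift, a map from a desuspended cell to [e]
    that dies in [x], so it is zero. The map then lifts to [x] and further to [e], hence vanishes in
    [f]. *)
Lemma cellular_perp (x : T) :
  (forall k, exists k', isomorphic (shift (C k')) (C k)) ->
  exists (X : nat -> T) (e f : T) (j : forall n, hom (X n) e) (p : hom e x)
    (q : hom x f) (r : hom f (shift e)),
  [/\ forall F : set T, (forall (I : small) (n : I -> K), F (coprod S (C \o n))) ->
        (forall a b z (f : hom a b) (g : hom b z) (h : hom z (shift a)),
          dist f g h -> F a -> F b -> F z) -> forall n, F (X n),
      forall L, localizing S L -> (forall k, L (C k)) -> L e,
      forall (c : T) (u : hom c e), compact_ob S c ->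
        exists n (v : hom c (X n)), u = j n ∘ v,
      dist p q r
    & forall k (h : hom (C k) f), h = 0].
Proof.
move=> Cd; have [X [e [j [p [H1 H2 H3 H4 H5]]]]] := cellular x.
have [f [q [r D]]] := dist_cone p.
exists X, e, f, j, p, q, r; split=> // k h.
have rh : r ∘ h = 0.
  have [k' [a]] := Cd k; apply: (@iso_injr _ _ _ _ a); rewrite comp0m.
  have [v vE] := shift_full (r ∘ h ∘ a).
  rewrite -vE (H5 _ v) ?fmap0//; first exact: shift_additive.
  apply: shift_inj; rewrite fmap_comp vE !compA (dist_comp0'' D) !comp0m.
  by rewrite fmap0//; exact: shift_additive.
have [u ->] := dist_kernel' D rh.
by have [v ->] := H4 _ u; rewrite compA (dist_comp0 D) comp0m.
Qed.

End Cellular.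

(** * Compact objects are essentially small *)

Lemma iso_yoneda (T : category) (y z : T) (f : hom y z) :
  (forall x, bijective (fun u : hom x y => f ∘ u)) -> exists a : iso y z, a = f :> hom y z.
Proof.
move=> fb; have [g gE] := bij_surj (fb z) (idm z).
have E : g ∘ f = idm y.
  by apply: (bij_inj (fb y)); rewrite compA gE comp1m compm1.
by exists (Iso E gE).
Qed.

Lemma cone_unique (T : triangulated) (x y z z' : T) (f : hom x y)
    (g : hom y z) (h : hom z (shift x)) (g' : hom y z') (h' : hom z' (shift x)) :
  dist f g h -> dist f g' h' -> isomorphic z z'.
Proof.
move=> D D'; have [|c [cg hc]] := dist_fill (a := idm x) (b := idm y) D D'.
  by rewrite comp1m compm1.
have idb (a b : T) : bijective (@id (hom a b)) by exists id.
have [w|a _] := iso_yoneda (f := c); last by constructor; exact: a.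
apply: (@five_hom _ _ _ _ _ _ _ _ _ _ _ _ _ _ w w id id _ id id D D') => //.
- by move=> u; rewrite compA cg compm1.
- by move=> u /=; rewrite compA -hc fmap_id comp1m.
- by move=> u v; rewrite compDr.
Qed.

Lemma biproduct_unique (C : preadditive) (x y b b' : C) :
  is_biproduct x y b -> is_biproduct x y b' -> isomorphic b b'.
Proof.
move=> [i [j [p [q [pi qj qi pj E]]]]] [i' [j' [p' [q' [pi' qj' qi' pj' E']]]]].
constructor; apply: (@Iso _ _ _ (i' ∘ p + j' ∘ q) (i ∘ p' + j ∘ q')).
  rewrite compDl !compDr -!compA !(comp_retract _ pi') !(comp_retract _ qj').
  by rewrite !(comp_zero _ qi') !(comp_zero _ pj') !compm0 addr0 add0r.
rewrite compDl !compDr -!compA !(comp_retract _ pi) !(comp_retract _ qj).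
by rewrite !(comp_zero _ qi) !(comp_zero _ pj) !compm0 addr0 add0r.
Qed.

Lemma is_biproduct_iso (C : preadditive) (x y x' y' b : C) :
  iso x x' -> iso y y' -> is_biproduct x y b -> is_biproduct x' y' b.
Proof.
move=> a c [i [j [p [q [pi qj qi pj E]]]]].
exists (i ∘ bwd a), (j ∘ bwd c), (a ∘ p), (c ∘ q); split.
- by rewrite -compA [p ∘ _]compA pi comp1m bwdK.
- by rewrite -compA [q ∘ _]compA qj comp1m bwdK.
- by rewrite -compA [q ∘ _]compA qi comp0m compm0.
- by rewrite -compA [p ∘ _]compA pj comp0m compm0.
- by rewrite -!compA !isoK.
Qed.

Section EssentiallySmall.
Variable T : triangulated.

(** Objects may form a larger type than [small], so only representatives up to isomorphism are
    indexed. Hom-sets are already small. *)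
Definition ess_small (A : set T) : Prop :=
  exists (K : small) (C : K -> T), forall x, A x -> exists k, isomorphic (C k) x.

Lemma ess_small_sub (A B : set T) : A `<=` B -> ess_small B -> ess_small A.
Proof. by move=> AB [K [C H]]; exists K, C => x /AB/H. Qed.

Lemma ess_small_union (A : nat -> set T) :
  (forall n, ess_small (A n)) -> ess_small [set x | exists n, A n x].
Proof.
move=> H; have /all_tag[K KP] n := cid (H n).
have /all_tag[C CP] n := cid (KP n).
exists {n & K n}, (fun w => C (tag w) (tagged w)) => x [n /CP[k a]].
by exists (Tagged K k).
Qed.

(** A retract is determined up to isomorphism by the idempotent [i ∘ r], and the endomorphisms of
    the representatives form a small type. *)
Lemma ess_small_retract (A : set T) :
  ess_small A -> ess_small [set x | exists y, A y /\ retract_of x y].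
Proof.
move=> [K [C H]].
pose splits (w : {k : K & hom (C k) (C k)}) (x : T) :=
  exists (i : hom x (C (tag w))) (r : hom (C (tag w)) x),
    r ∘ i = idm x /\ i ∘ r = tagged w.
(* An endomorphism that does not split receives [C (tag w)] as a dummy value. *)
have /choice[D DP] : forall w, exists d, (exists x, splits w x) -> splits w d.
  move=> w; have [[x xP]|N] := EM (exists x, splits w x); first by exists x.
  by exists (C (tag w)) => /N.
exists {k : K & hom (C k) (C k)}, D => x [y [/H[k [a]] [i [r ri]]]].
pose w : {k : K & hom (C k) (C k)} :=
  Tagged (fun k => hom (C k) (C k)) (bwd a ∘ i ∘ (r ∘ a)).
have xw : splits w x.
  exists (bwd a ∘ i), (r ∘ a); split=> //.
  by rewrite -compA isoKV.
have [i' [r' [r'i' i'r']]] := DP w (ex_intro _ x xw).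
exists w; move: xw => [j [s [sj js]]].
constructor; apply: (@Iso _ _ _ (s ∘ i') (r' ∘ j)).
  by rewrite -compA [j ∘ _]compA js -i'r' -!compA [r' ∘ (i' ∘ _)]compA r'i' comp1m.
by rewrite -compA [i' ∘ _]compA i'r' -js -!compA [s ∘ (j ∘ _)]compA sj comp1m.
Qed.

(** Biproducts form a separate clause because writing one as a cone would use a desuspension of a
    summand. *)
Definition ext_step (A : set T) : set T :=
  [set z | [\/ A z,
    exists (x y : T) (f : hom x y) (g : hom y z) (h : hom z (shift x)),
      [/\ A x, A y & dist f g h]
  | exists x y, [/\ A x, A y & is_biproduct x y z]]].

Lemma ess_small_ext_step (A : set T) : ess_small A -> ess_small (ext_step A).
Proof.
move=> [K [C H]].
have /choice[D1 D1P] : forall w : {ab : K * K & hom (C ab.1) (C ab.2)}, exists z,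
    exists g h, dist (z := z) (tagged w) g h.
  by move=> w; have [z [g [h D]]] := dist_cone (tagged w); exists z, g, h.
have /choice[D2 D2P] : forall w : K * K, exists z, is_biproduct (C w.1) (C w.2) z.
  by move=> w; exact: biproduct_ex.
exists (K + ({ab : K * K & hom (C ab.1) (C ab.2)} + K * K))%type,
  (fun w => match w with inl k => C k | inr (inl v) => D1 v | inr (inr v) => D2 v end).
move=> z [/H[k a]|[x [y [f [g [h [/H[k [a]] /H[l [b]] D]]]]]]
  |[x [y [/H[k [a]] /H[l [b]] D]]]].
- by exists (inl k).
- pose w : {ab : K * K & hom (C ab.1) (C ab.2)} :=
    Tagged (fun ab => hom (C ab.1) (C ab.2)) (i := (k, l)) (bwd b ∘ f ∘ a).
  exists (inr (inl w)); have [g' [h' D']] := D1P w.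
  apply: isomorphic_sym.
  apply: (@cone_unique _ x y _ _ f g h (g' ∘ bwd b) (fmap shift a ∘ h') D).
  apply: (@dist_iso _ _ _ _ _ _ _ _ _ _ _ _ _ a b (iso_refl _) _ _ _ D') => /=.
  + by rewrite -compA isoKV.
  + by rewrite -compA fwdK comp1m compm1.
  + by rewrite compm1.
- exists (inr (inr (k, l))); apply: biproduct_unique (D2P (k, l)) _.
  exact: is_biproduct_iso (iso_sym a) (iso_sym b) D.
Qed.

Definition fin_ext (A : set T) : set T :=
  [set x | exists n, iter n ext_step A x].

Lemma ess_small_fin_ext (A : set T) : ess_small A -> ess_small (fin_ext A).
Proof.
move=> eA; apply: ess_small_union; elim=> [//|n IH]; exact: ess_small_ext_step.
Qed.

Lemma fin_ext_le (A : set T) n m x :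
  (n <= m)%N -> iter n ext_step A x -> iter m ext_step A x.
Proof.
by move=> /subnK <-; elim: (m - n)%N => [//|k IH] /IH H; constructor 1.
Qed.

Lemma fin_ext_cone (A : set T) (x y z : T) (f : hom x y) (g : hom y z)
    (h : hom z (shift x)) :
  dist f g h -> fin_ext A x -> fin_ext A y -> fin_ext A z.
Proof.
move=> D [n nx] [m my]; exists (maxn n m).+1; constructor 2.
exists x, y, f, g, h; split=> //.
  exact: fin_ext_le (leq_maxl _ _) nx.
exact: fin_ext_le (leq_maxr _ _) my.
Qed.

Lemma fin_ext_biproduct (A : set T) (x y z : T) :
  is_biproduct x y z -> fin_ext A x -> fin_ext A y -> fin_ext A z.
Proof.
move=> D [n nx] [m my]; exists (maxn n m).+1; constructor 3.
exists x, y; split=> //.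
  exact: fin_ext_le (leq_maxl _ _) nx.
exact: fin_ext_le (leq_maxr _ _) my.
Qed.

Lemma fin_ext_compact (S : has_coproducts T) (A : set T) :
  A `<=` compact_ob S -> fin_ext A `<=` compact_ob S.
Proof.
move=> Ac x [n]; elim: n x => [|n IH] x; first exact: Ac.
case=> [/IH//|[y [z [f [g [h [/IH cy /IH cz D]]]]]]|[y [z [/IH cy /IH cz D]]]].
  exact: compact_cone D cy cz.
exact: compact_biproduct D cy cz.
Qed.

End EssentiallySmall.

Section CompactRetract.
Variables (T : triangulated) (S : has_coproducts T) (A : set T).
Hypotheses (A_compact : A `<=` compact_ob S) (A_zero : forall z, is_zero z -> A z).

Let B := fin_ext A.

(** The property in Neeman's argument that survives cell attachment. Applied to the stage through
    which the identity of a compact object factors, it exhibits that object as a retract of a finite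
    extension. *)
Definition factors_fin (y : T) : Prop :=
  forall (x : T) (u : hom x y), compact_ob S x ->
    exists (b : T) (v : hom x b) (w : hom b y), B b /\ u = w ∘ v.

Lemma factors_finD (x y : T) (u u' : hom x y) :
  (exists (b : T) (v : hom x b) (w : hom b y), B b /\ u = w ∘ v) ->
  (exists (b : T) (v : hom x b) (w : hom b y), B b /\ u' = w ∘ v) ->
  exists (b : T) (v : hom x b) (w : hom b y), B b /\ u + u' = w ∘ v.
Proof.
move=> [b [v [w [Bb ->]]]] [b' [v' [w' [Bb' ->]]]].
have [c cP] := biproduct_ex b b'; exists c.
have [i [j [p [q [pi qj qi pj E]]]]] := cP.
exists (i ∘ v + j ∘ v'), (w ∘ p + w' ∘ q); split.
  exact: fin_ext_biproduct cP Bb Bb'.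
rewrite compDl !compDr -!compA !(comp_retract _ pi) !(comp_retract _ qj).
by rewrite !(comp_zero _ qi) !(comp_zero _ pj) !compm0 addr0 add0r.
Qed.

Lemma factors_fin_coproduct (I : small) (X : I -> T) :
  (forall i, A (X i)) -> factors_fin (coprod S X).
Proof.
move=> XA x u cx; have [s ->] := iffLR (compactP S x) cx I X u.
elim: s => [|w s IH].
  have [z z0] := zero_ex T; exists z, 0, 0; rewrite big_nil comp0m; split=> //.
  by exists 0%N; exact: A_zero.
rewrite big_cons; apply: factors_finD => //.
exists (X (tag w)), (tagged w), (inj S X (tag w)); split=> //.
by exists 0%N; exact: XA.
Qed.

(** First the boundary of [u] is realised: desuspended, it factors through some [b1]. The map
    [b1 -> y] then factors through the compact cone [b0] and hence through some [b2], and the cone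
    [b'] of [b1 -> b2] maps to [z]. Subtracting the resulting map [x -> b' -> z] from [u] removes
    the boundary, so the difference comes from [y]. *)
Lemma factors_fin_cone (a y z : T) (f : hom a y) (g : hom y z) (h : hom z (shift a)) :
  dist f g h -> factors_fin a -> factors_fin y -> factors_fin z.
Proof.
move=> D Fa Fy x u cx.
have [x' [s]] := shift_surj x.
have cx' : compact_ob S x'.
  by apply/compact_shift; apply: compact_iso cx; constructor; exact: iso_sym s.
have [v vE] := shift_full (h ∘ u ∘ s).
have [b1 [v1 [j [Bb1 vj]]]] := Fa _ v cx'.
have fv : f ∘ v = 0.
  apply: shift_inj; rewrite fmap_comp vE !compA (dist_comp0'' D) !comp0m.
  by rewrite fmap0//; exact: shift_additive.
have [b0 [k [l D0]]] := dist_cone v1.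
have [|q qE] := dist_cokernel (k := f ∘ j) D0; first by rewrite -compA -vj.
have cb1 : compact_ob S b1 := fin_ext_compact A_compact Bb1.
have [b2 [m [n [Bb2 qmn]]]] := Fy _ q (compact_cone D0 cx' cb1).
have [b' [g' [h' D']]] := dist_cone (m ∘ k).
have [|t [tg ht]] := dist_fill (a := j) (b := n) D' D.
  by rewrite compA -qmn -qE.
have Bb' : B b' by exact: fin_ext_cone D' Bb1 Bb2.
have [|u' u'E] := dist_kernel'' (k := fmap shift v1 ∘ bwd s) D'.
  rewrite compA -fmap_comp -compA (dist_comp0 D0) compm0.
  by rewrite fmap0 ?comp0m//; exact: shift_additive.
have hE : h ∘ (u - t ∘ u') = 0.
  rewrite compDr compNr compA -ht -compA -u'E compA -fmap_comp -vj vE.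
  by rewrite -!compA bwdK compm1 subrr.
have [u2 u2E] := dist_kernel' D hE.
rewrite -[u](subrK (t ∘ u')) u2E; apply: factors_finD.
  have [b3 [v3 [w3 [Bb3 ->]]]] := Fy _ u2 cx.
  by exists b3, v3, (g ∘ w3); rewrite compA.
by exists b', u', t.
Qed.

End CompactRetract.

Section DesuspensionClosure.
Variables (T : triangulated) (J : small) (G : J -> T).

Lemma shift_closure : exists (K : small) (C : K -> T),
  [/\ forall j, exists k, C k = G j,
      forall k, exists k', isomorphic (shift (C k')) (C k),
      forall k, exists k', isomorphic (C k') (shift (C k))
    & forall S : has_coproducts T,
        (forall j, compact_ob S (G j)) -> forall k, compact_ob S (C k)].
Proof.
have /choice[om omE] := @shift_surj T.
(* The pair [w.2] encodes an integer: [true] for iterated shifts, [false] for chosen desuspensions,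
   with two encodings of zero. *)
pose C (w : J * (bool * nat)) :=
  iter w.2.2 (if w.2.1 then @shift T : T -> T else om) (G w.1).
exists (J * (bool * nat))%type, C; split.
- by move=> j; exists (j, (true, 0%N)).
- move=> [j [[] [|n]]].
  + by exists (j, (false, 1%N)); exact: omE.
  + by exists (j, (true, n)); exact: isomorphic_refl.
  + by exists (j, (false, 1%N)); exact: omE.
  + by exists (j, (false, n.+2)); exact: omE.
- move=> [j [[] n]]; first by exists (j, (true, n.+1)); exact: isomorphic_refl.
  case: n => [|n]; first by exists (j, (true, 1%N)); exact: isomorphic_refl.
  by exists (j, (false, n)); apply: isomorphic_sym; exact: omE.
- move=> S Gc [j [[] n]]; rewrite /C/=; elim: n => [|n IH] //=.
    exact: (iffLR (compact_shift S _)).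
  by apply/compact_shift; apply: compact_iso IH; exact/isomorphic_sym/omE.
Qed.

End DesuspensionClosure.

(** Approximating a compact [x] by shifted generators gives [e] isomorphic to [x]. By compactness
    the inverse isomorphism passes through a finite stage, and there through a finite extension. *)
Lemma compact_ess_small (T : triangulated) (S : has_coproducts T) (J : small)
    (G : J -> T) : (forall j, compact_ob S (G j)) ->
  (forall L, localizing S L -> (forall j, L (G j)) -> forall x, L x) ->
  ess_small (compact_ob S).
Proof.
move=> Gc Gg; have [K [C [GC Cd Cs /(_ S Gc) Cc]]] := shift_closure G.
(* Zero objects are included because a map given by an empty sum must factor too. *)
pose A : set T := [set x | is_zero x \/ exists k, C k = x].
have Ac : A `<=` compact_ob S.
  by move=> x [|[k <-]]; [exact: compact_zero|exact: Cc].
have eA : ess_small A.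
  have [z z0] := zero_ex T.
  exists (option K), (fun k => if k is Some k then C k else z) => x [x0|[k <-]].
    by exists None; exact: zero_isomorphic.
  by exists (Some k); exact: isomorphic_refl.
apply: ess_small_sub (ess_small_retract (ess_small_fin_ext eA)) => x cx.
have [X [e [f [j [p [q [r [XF _ ej D Cf]]]]]]]] := cellular_perp Cc x Cd.
have f0 : is_zero f.
  pose A' : set T := [set c | exists k, isomorphic (C k) c].
  apply: (@generators_detect _ S A').
  - split=> c [k a].
      have [k' b] := Cs k; exists k'; apply: (isomorphic_trans b).
      by case: a => a; constructor; exact: fmap_iso a.
    have [k' b] := Cd k; exists (C k'); split; last exact: isomorphic_trans b a.
    by exists k'; exact: isomorphic_refl.
  - move=> L lL AL; apply: Gg => // i; have [k <-] := GC i.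
    by apply: AL; exists k; exact: isomorphic_refl.
  - by move=> c [k a]; apply: hom_iso_zero a _ => h; exact: Cf.
have [a aE] := dist_iso_of_zero D f0.
have [n [v vE]] := ej _ (bwd a) cx.
have FX : factors_fin S A (X n).
  apply: XF => [I m|]; last exact: factors_fin_cone.
  by apply: factors_fin_coproduct => [z|i]; [left|right; exists (m i)].
have [b [s [w [Bb E]]]] := FX _ v cx.
exists b; split=> //; exists s, (a ∘ (j n ∘ w)).
by rewrite -!compA -E -vE bwdK.
Qed.

(** * Duality *)

Section Duality.
Variables (C : category) (M : sym_monoidal C).
Local Notation "x ⊗ y" := (tens M x y) : cat_scope.
Local Notation "f ⊗m g" := (tensm M f g) : cat_scope.
Local Notation "'𝟙'" := (tunit M) : cat_scope.

Lemma tens1l_inj (x y : C) (f g : hom x y) :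
  idm 𝟙 ⊗m f = idm 𝟙 ⊗m g -> f = g.
Proof.
move=> E; apply: (@iso_injr _ _ _ _ (lunit M x)).
by rewrite -!lunit_nat E.
Qed.

(** Kelly's coherence argument: after tensoring with the unit, which is faithful, the claim follows
    from pentagon and triangle. *)
Lemma lunit_tens (x y : C) :
  lunit M (x ⊗ y) ∘ tassoc M 𝟙 x y = lunit M x ⊗m idm y.
Proof.
apply: tens1l_inj; rewrite tensml_comp.
apply: (@iso_injr _ _ _ _ (tassoc M 𝟙 (𝟙 ⊗ x) y)).
apply: (@iso_injr _ _ _ _ (fmap_iso (tensr M y) (tassoc M 𝟙 𝟙 x))) => /=.
rewrite -!compA [X in _ ∘ X]compA -pentagon compA triangle.
rewrite -(tensm_id M x y) -tassoc_nat [RHS]compA -tassoc_nat -[RHS]compA.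
by rewrite -tensmr_comp triangle.
Qed.

Record dual_pair (x y : C) (ev : hom (y ⊗ x) 𝟙) (coev : hom 𝟙 (x ⊗ y)) : Prop :=
  DualPair {
  dual_zigzag : runit M x ∘ (idm x ⊗m ev) ∘ tassoc M x y x
      ∘ (coev ⊗m idm x) ∘ bwd (lunit M x) = idm x;
  dual_zagzig : lunit M y ∘ (ev ⊗m idm y) ∘ bwd (tassoc M y x y)
      ∘ (idm y ⊗m coev) ∘ bwd (runit M y) = idm y
}.

Section Transpose.
Variables (x y : C) (ev : hom (y ⊗ x) 𝟙) (coev : hom 𝟙 (x ⊗ y)).
Hypothesis xy : dual_pair ev coev.

(** The adjunction between [y ⊗ -] and [x ⊗ -], with unit built from [coev] and counit from [ev]. *)
Definition transposeL (z b : C) (v : hom (y ⊗ z) b) : hom z (x ⊗ b) :=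
  (idm x ⊗m v) ∘ tassoc M x y z ∘ (coev ⊗m idm z) ∘ bwd (lunit M z).

Definition transposeR (z b : C) (u : hom z (x ⊗ b)) : hom (y ⊗ z) b :=
  lunit M b ∘ (ev ⊗m idm b) ∘ bwd (tassoc M y x b) ∘ (idm y ⊗m u).

Lemma bwd_lunit_nat (z w : C) (f : hom z w) :
  bwd (lunit M w) ∘ f = (idm 𝟙 ⊗m f) ∘ bwd (lunit M z).
Proof.
apply: (@iso_injl _ _ _ _ (lunit M w)); rewrite isoKV compA lunit_nat -compA.
by rewrite bwdK compm1.
Qed.

Lemma bwd_runit_nat (z w : C) (f : hom z w) :
  bwd (runit M w) ∘ f = (f ⊗m idm 𝟙) ∘ bwd (runit M z).
Proof.
apply: (@iso_injl _ _ _ _ (runit M w)); rewrite isoKV compA runit_nat -compA.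
by rewrite bwdK compm1.
Qed.

Lemma tensm_exchange (z z' w w' : C) (f : hom z z') (g : hom w w') :
  (f ⊗m idm w') ∘ (idm z ⊗m g) = (idm z' ⊗m g) ∘ (f ⊗m idm w).
Proof. by rewrite -!tensm_comp !comp1m !compm1. Qed.

Lemma transposeLK (z b : C) (u : hom z (x ⊗ b)) : transposeL (transposeR u) = u.
Proof.
rewrite /transposeL /transposeR !tensml_comp -!compA.
rewrite [(idm x ⊗m (idm y ⊗m u)) ∘ _]compA -tassoc_nat -!compA tensm_id.
rewrite [(idm (x ⊗ y) ⊗m u) ∘ _]compA -tensm_exchange -compA -bwd_lunit_nat.
rewrite !compA -[RHS]comp1m; congr (_ ∘ _).
have -> : bwd (lunit M (x ⊗ b)) = tassoc M 𝟙 x b ∘ (bwd (lunit M x) ⊗m idm b).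
  apply: (@iso_injl _ _ _ _ (lunit M (x ⊗ b))).
  by rewrite bwdK compA lunit_tens -tensmr_comp bwdK tensm_id.
rewrite -[idm (x ⊗ b)](tensm_id M) -!compA [(coev ⊗m _) ∘ _]compA -tassoc_nat.
rewrite -!compA [tassoc M x y _ ∘ _]compA pentagon -!compA.
rewrite [(idm x ⊗m bwd _) ∘ _]compA -tensml_comp fwdK tensm_id comp1m.
rewrite [(idm x ⊗m (ev ⊗m _)) ∘ _]compA -tassoc_nat -!compA.
rewrite [(idm x ⊗m lunit M b) ∘ _]compA triangle -!tensmr_comp !compA.
by rewrite (dual_zigzag xy).
Qed.

Lemma transposeRK (z b : C) (v : hom (y ⊗ z) b) : transposeR (transposeL v) = v.
Proof.
rewrite /transposeL /transposeR !tensml_comp -!compA.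
have -> : bwd (tassoc M y x b) ∘ ((idm y ⊗m (idm x ⊗m v)) ∘
      ((idm y ⊗m tassoc M x y z) ∘ ((idm y ⊗m (coev ⊗m idm z)) ∘
        (idm y ⊗m bwd (lunit M z))))) =
    (idm (y ⊗ x) ⊗m v) ∘ (bwd (tassoc M y x (y ⊗ z)) ∘
      ((idm y ⊗m tassoc M x y z) ∘ ((idm y ⊗m (coev ⊗m idm z)) ∘
        (idm y ⊗m bwd (lunit M z))))).
  apply: (@iso_injl _ _ _ _ (tassoc M y x b)); rewrite isoKV.
  by rewrite [RHS]compA -(tensm_id M y x) tassoc_nat -[RHS]compA isoKV.
rewrite [(ev ⊗m _) ∘ _]compA tensm_exchange -!compA.
rewrite [lunit M b ∘ _]compA lunit_nat -compA -[RHS]compm1; congr (_ ∘ _).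
have -> : idm y ⊗m bwd (lunit M z) = tassoc M y 𝟙 z ∘ (bwd (runit M y) ⊗m idm z).
  apply: (@iso_injl _ _ _ _ (fmap_iso (tensl M y) (lunit M z))) => /=.
  by rewrite -tensml_comp bwdK compA triangle -tensmr_comp bwdK !tensm_id.
rewrite [(idm y ⊗m (coev ⊗m idm z)) ∘ _]compA -tassoc_nat -!compA.
have -> : bwd (tassoc M y x (y ⊗ z)) ∘ ((idm y ⊗m tassoc M x y z) ∘
      (tassoc M y (x ⊗ y) z ∘ ((idm y ⊗m coev ⊗m idm z) ∘
        (bwd (runit M y) ⊗m idm z)))) =
    tassoc M (y ⊗ x) y z ∘ ((bwd (tassoc M y x y) ⊗m idm z) ∘
      ((idm y ⊗m coev ⊗m idm z) ∘ (bwd (runit M y) ⊗m idm z))).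
  apply: (@iso_injl _ _ _ _ (tassoc M y x (y ⊗ z))); rewrite isoKV compA.
  rewrite [RHS]compA pentagon -!compA; congr (_ ∘ (_ ∘ _)).
  by rewrite [RHS]compA -[X in _ = X ∘ _]tensmr_comp bwdK tensm_id comp1m.
rewrite -(tensm_id M y z) [(ev ⊗m _) ∘ _]compA -tassoc_nat -!compA.
rewrite [lunit M _ ∘ _]compA lunit_tens -!tensmr_comp !compA.
by rewrite (dual_zagzig xy) tensm_id.
Qed.

Lemma transposeL_bij (z b : C) : bijective (@transposeL z b).
Proof. by exists (@transposeR z b); [exact: transposeRK|exact: transposeLK]. Qed.

Lemma transposeR_nat (z b b' : C) (w : hom b b') (u : hom z (x ⊗ b)) :
  transposeR ((idm x ⊗m w) ∘ u) = w ∘ transposeR u.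
Proof.
apply: (bij_inj (transposeL_bij z b')); rewrite transposeLK.
by rewrite /transposeL tensml_comp -!compA -[in LHS](transposeLK u) /transposeL -!compA.
Qed.

End Transpose.

End Duality.

Lemma rigid_dual (C : category) (M : sym_monoidal C) (x : C) : rigid_ob M x ->
  exists y (ev : hom (tens M y x) (tunit M)) (coev : hom (tunit M) (tens M x y)),
    dual_pair ev coev.
Proof. by move=> [y [ev [coev [H1 H2]]]]; exists y, ev, coev. Qed.

Section TensorObjects.
Variable T : bigtt.
Implicit Types x y z w : T.
Let M := tt_mon T.

Lemma tens_isol x y z : isomorphic x y -> isomorphic (z ⊗ x) (z ⊗ y).
Proof. by move=> [a]; constructor; exact: (fmap_iso (tensl M z) a). Qed.

Lemma tens_isor x y z : isomorphic x y -> isomorphic (x ⊗ z) (y ⊗ z).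
Proof. by move=> [a]; constructor; exact: (fmap_iso (tensr M z) a). Qed.

Lemma tensC x y : isomorphic (x ⊗ y) (y ⊗ x).
Proof. by constructor; exact: braid. Qed.

Lemma tensA x y z : isomorphic ((x ⊗ y) ⊗ z) (x ⊗ (y ⊗ z)).
Proof. by constructor; exact: tassoc. Qed.

Lemma tensCA x y z : isomorphic (x ⊗ (y ⊗ z)) (y ⊗ (x ⊗ z)).
Proof.
apply: isomorphic_trans (isomorphic_sym (tensA _ _ _)) _.
exact: isomorphic_trans (tens_isor _ (tensC _ _)) (tensA _ _ _).
Qed.

Lemma tens1l x : isomorphic (𝟙 ⊗ x) x.
Proof. by constructor; exact: lunit. Qed.

Lemma tens1r x : isomorphic (x ⊗ 𝟙) x.
Proof. by constructor; exact: runit. Qed.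

Lemma tens_zerol x z : is_zero z -> is_zero (x ⊗ z).
Proof. by move=> z0; exact: (exact_zero (tensl_exact x) z0). Qed.

Lemma tens_zeror x z : is_zero z -> is_zero (z ⊗ x).
Proof. by move=> z0; exact: (exact_zero (tensr_exact x) z0). Qed.

Lemma compacts_iso x y : isomorphic x y -> compacts x -> compacts y.
Proof. exact: compact_iso. Qed.

Lemma compacts_shift x : compacts x <-> compacts (shift x).
Proof. exact: compact_shift. Qed.

(** Maps from [y] to an object [b] correspond to maps from the compact unit to [x ⊗ b], and [x ⊗ -]
    preserves coproducts. This avoids rewriting the duality with [x] and [y] exchanged. *)
Lemma dual_compact x y (ev : hom (y ⊗ x) 𝟙) (coev : hom 𝟙 (x ⊗ y)) :
  dual_pair ev coev -> compacts y.
Proof.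
move=> xy; apply: compacts_iso (tens1r y) _; apply/compactP => I X u.
have [k kE] : exists k : hom 𝟙 (x ⊗ _), transposeR ev k = u.
  by exists (transposeL coev u); exact: (transposeRK xy).
have [s sE] := compact_coproduct k (@compacts_unit T)
  (@tensl_coprod T x I X _ _ (coprodP (tt_cop T) X)).
rewrite -kE sE; elim: s {sE} => [|v s IH].
  rewrite big_nil /transposeR [idm y ⊗m 0](fmap0 _ _ (tensl_exact y).1) compm0.
  exact: fin_supp0.
rewrite big_cons {1}/transposeR [idm y ⊗m _]((tensl_exact y).1) compDr.
apply: fin_suppD IH; rewrite -[X in fin_supp _ X]/(transposeR ev _) /=.
rewrite (transposeR_nat xy); exact: fin_supp1.
Qed.

(* This makes every thick ideal of compact objects radical. *)
Lemma rigid_retract x : compacts x ->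
  exists y, compacts y /\ retract_of x (y ⊗ (x ⊗ x)).
Proof.
move=> /compact_rigid/rigid_dual[y [ev [coev xy]]]; exists y; split.
  exact: dual_compact xy.
have [a] : isomorphic ((x ⊗ y) ⊗ x) (y ⊗ (x ⊗ x)).
  exact: isomorphic_trans (tensA _ _ _) (tensCA _ _ _).
exists (a ∘ ((coev ⊗m idm x) ∘ bwd (lunit M x))),
    (runit M x ∘ (idm x ⊗m ev) ∘ tassoc M x y x ∘ bwd a).
by rewrite -!compA isoK !compA (dual_zigzag xy).
Qed.

End TensorObjects.

(** * Thick ideals and primes *)

Section ThickIdeals.
Variable T : bigtt.
Implicit Types x y z w : T.

Record thick_ideal (A : set T) : Prop := ThickIdeal {
  thick_tri : triangulated_in (@compacts T) A;
  thick_retract : forall x y, compacts x -> retract_of x y -> A y -> A x;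
  thick_tens : forall x y, A x -> compacts y -> A (y ⊗ x)
}.

Lemma prime_thick (P : set T) : prime_ideal P -> thick_ideal P.
Proof. by case. Qed.

Lemma thick_compact (A : set T) x : thick_ideal A -> A x -> compacts x.
Proof. by move=> [tA _ _]; exact: tri_sub tA _. Qed.

Lemma thick_iso (A : set T) x y : thick_ideal A -> isomorphic x y -> A x -> A y.
Proof.
move=> tA xy Ax; apply: (thick_retract tA _ _ Ax).
  by apply: compacts_iso xy _; exact: (thick_compact tA Ax).
by case: xy => a; exists (bwd a), a; exact: bwdK.
Qed.

Lemma thick_shift (A : set T) x : thick_ideal A -> compacts x -> A x <-> A (shift x).
Proof.
move=> tA cx; apply: (tri_shift (thick_tri tA)) => //; first exact: compacts_zero.
exact: (iffLR (compacts_shift _)).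
Qed.

Lemma thick_square (A : set T) x : thick_ideal A -> compacts x -> A (x ⊗ x) -> A x.
Proof.
move=> tA cx Axx; have [y [cy xy]] := rigid_retract cx.
by apply: (thick_retract tA cx xy); exact: (thick_tens tA).
Qed.

Lemma thick_tensr (A : set T) x y : thick_ideal A -> A x -> compacts y -> A (x ⊗ y).
Proof.
by move=> tA Ax cy; apply: (thick_iso tA (tensC y x)); exact: (thick_tens tA).
Qed.

(** With [thick_supp], this lets vanishing of [z ⊗ w] be tested along the support of [z]. *)
Lemma thick_annihilator w : thick_ideal [set z | compacts z /\ is_zero (z ⊗ w)].
Proof.
split.
- apply: (triangulated_preimage (tensr_exact w) (P := setT)) => //.
    exact: compacts_zero.
  exact: loc_tri (localizing_is_zero (tt_cop T)).
- move=> x y cx [i [r ri]] [cy y0]; split=> //; apply: is_zero_retract y0.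
  by exists (i ⊗m idm w), (r ⊗m idm w); rewrite -tensm_comp ri comp1m tensm_id.
- move=> x y [cx x0] cy; split; first exact: compacts_tens.
  by apply: is_zero_iso (tensA _ _ _) _; exact: tens_zerol.
Qed.

Lemma thick_colon (A : set T) b : thick_ideal A -> compacts b ->
  thick_ideal [set c | compacts c /\ A (c ⊗ b)].
Proof.
move=> tA cb; split.
- apply: (triangulated_preimage (tensr_exact b)) (thick_tri tA).
    by move=> x cx; exact: compacts_tens.
  exact: compacts_zero.
- move=> x y cx [i [r ri]] [cy Ay]; split=> //; apply: (thick_retract tA) Ay.
    exact: compacts_tens.
  by exists (i ⊗m idm b), (r ⊗m idm b); rewrite -tensm_comp ri comp1m tensm_id.
- move=> x y [cx Ax] cy; split; first exact: compacts_tens.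
  apply: (thick_iso tA) (isomorphic_sym (tensA _ _ _)) _.
  exact: (thick_tens tA).
Qed.

Lemma thick_chain (F : set (set T)) : F !=set0 -> F `<=` thick_ideal ->
  total_on F subset -> thick_ideal (\bigcup_(A in F) A).
Proof.
move=> [A0 FA0] Ft Ftot.
have dir A B : F A -> F B -> exists D, [/\ F D, A `<=` D & B `<=` D].
  by move=> FA FB; have [AB|BA] := Ftot _ _ FA FB; [exists B|exists A]; split.
split.
- split=> [x [A FA Ax]|z z0|x y z f g h D cx cy cz].
  + exact: thick_compact (Ft _ FA) Ax.
  + by exists A0 => //; exact: (tri_zero (thick_tri (Ft _ FA0)) z0).
  + split=> -[A FA Ax] [B FB Bx]; have [E [FE AE BE]] := dir _ _ FA FB;
      exists E => //; have [H1 H2 H3] :=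
        tri_two_of_three (thick_tri (Ft _ FE)) D cx cy cz.
    * by apply: H1; [exact: AE|exact: BE].
    * by apply: H2; [exact: AE|exact: BE].
    * by apply: H3; [exact: AE|exact: BE].
- move=> x y cx xy [A FA Ay]; exists A => //.
  exact: (thick_retract (Ft _ FA) cx xy).
- by move=> x y [A FA Ax] cy; exists A => //; exact: (thick_tens (Ft _ FA) Ax cy).
Qed.

(** An ideal maximal among those containing [A] but not [x] is prime, by the usual colon-ideal
    argument together with radicality. *)
Lemma prime_avoiding (A : set T) x : thick_ideal A -> compacts x -> ~ A x ->
  exists P : set T, [/\ prime_ideal P, A `<=` P & ~ P x].
Proof.
move=> tA cx Ax.
pose good (B : set T) := [/\ thick_ideal B, A `<=` B & ~ B x].
have goodA : good A by split.
have [|P [Pg Pmax]] := @Zorn_bigcup T (fun B => B = set0 \/ good B).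
  move=> F Fgood Ftot; pose F' := F `&` good.
  have FF' : \bigcup_(B in F) B = \bigcup_(B in F') B.
    apply/seteqP; split=> y [B FB By]; last by exists B => //; case: FB.
    by have [B0|Bg] := Fgood _ FB; [rewrite B0 in By|exists B].
  have [[B0 F'B0]|N] := EM (F' !=set0); last first.
    left; rewrite FF'; apply/seteqP; split=> y // [B F'B _].
    by case: N; exists B.
  right; rewrite FF'; split.
  - apply: thick_chain => [|B [_ []]//|B B' [FB _] [FB' _]]; first by exists B0.
    exact: Ftot.
  - by move=> y Ay; exists B0 => //; case: F'B0 => _ [_ + _]; exact.
  - by move=> [B [_ [_ _ NBx]]].
have {Pg} [tP AP Px] : good P.
  case: Pg => // P0; exfalso; apply: (Pmax A); last by right.
  rewrite P0; have [z z0] := zero_ex T; split=> // /(_ z).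
  by apply; exact: (tri_zero (thick_tri tA)).
have Pmax' B c : thick_ideal B -> P `<=` B -> B c -> ~ P c -> B x.
  move=> tB PB Bc Pc; apply: contrapT => NBx; apply: (Pmax B).
    by split=> // /(_ _ Bc).
  by right; split=> // y /AP/PB.
exists P; split=> //; split; try by case: tP.
  move=> P1; apply: Px; apply: (thick_iso tP (tens1r x)).
  exact: (thick_tens tP).
move=> a b ca cb Pab; apply: contrapT => /not_orP[NPa NPb].
have sub c : compacts c -> P `<=` [set d | compacts d /\ P (d ⊗ c)].
  move=> cc d Pd; split; first exact: thick_compact Pd.
  exact: (thick_tensr tP).
(* The colon ideal of [b] strictly contains [P], hence contains [x]. Then the colon ideal of [x]
   contains [b], hence also [x], and [x ⊗ x] lies in [P]. *)
have [_ Pxb] := Pmax' _ a (thick_colon tP cb) (sub _ cb) (conj ca Pab) NPa.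
have Pbx : P (b ⊗ x) := thick_iso tP (tensC _ _) Pxb.
have [_ Pxx] := Pmax' _ b (thick_colon tP cx) (sub _ cx) (conj cb Pbx) NPb.
exact/Px/(thick_square tP cx).
Qed.

Lemma thick_supp (A : set T) x : thick_ideal A -> compacts x ->
  (forall P : Spc T, supp x P -> exists2 a, A a & supp a P) -> A x.
Proof.
move=> tA cx H; apply: contrapT => NAx.
have [P [pP AP Px]] := prime_avoiding tA cx NAx.
by have [a /AP] := H (exist _ P pP) Px.
Qed.

Lemma spc_tens (P : Spc T) x y : compacts x -> compacts y ->
  sval P (x ⊗ y) <-> sval P x \/ sval P y.
Proof.
have pP := svalP P; have tP := prime_thick pP.
move=> cx cy; split; first exact: prime_prime.
by case=> H; [exact: (thick_tensr tP)|exact: (thick_tens tP)].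
Qed.

(** The direct sum, built as the cone of the zero map from a desuspension of [y] to [x]. It shows
    that finite intersections of subbasic open sets are subbasic. *)
Lemma thick_sum x y : compacts x -> compacts y -> exists z, compacts z /\
  forall A, thick_ideal A -> A z <-> A x /\ A y.
Proof.
move=> cx cy; have [a a_y] := shift_surj y.
have ca : compacts a.
  by apply/compacts_shift; exact: compacts_iso (isomorphic_sym a_y) cy.
have [z [g [h D]]] := dist_cone (0 : hom a x).
have cz : compacts z := compact_cone D ca cx.
exists z; split=> // A tA; split=> [Az|[Ax Ay]]; last first.
  have [H _ _] := tri_two_of_three (thick_tri tA) D ca cx cz.
  apply: H Ax; apply/(thick_shift tA ca).
  exact: (thick_iso tA (isomorphic_sym a_y)).
split.
  have [r rE] : exists r, idm x = r ∘ g by apply: (dist_cokernel D); rewrite compm0.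
  by apply: (thick_retract tA cx) Az; exists g, r.
apply: (thick_iso tA a_y).
have [s sE] : exists s, idm (shift a) = h ∘ s.
  by apply: (dist_kernel'' D); rewrite fmap0 ?comp0m//; exact: shift_additive.
apply: (thick_retract tA) Az; first exact: (iffLR (compacts_shift _)).
by exists s, h.
Qed.

(** * Supports and the topology of the spectrum *)

Lemma open_supp x : compacts x -> open (~` supp x : set (Spc T)).
Proof.
move=> cx; exists [set ~` supp x]; last by rewrite bigcup_set1.
by move=> _ ->; apply: (@finI_from1 _ _ _ id); exists x.
Qed.

Lemma spc_base_seq (s : seq (set (Spc T))) (P : Spc T) :
  (forall V, V \in s -> [set ~` supp x | x in @compacts T] V /\ V P) ->
  exists2 z, compacts z & sval P z /\
    forall Q : Spc T, sval Q z -> forall V, V \in s -> V Q.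
Proof.
elim: s => [|V s IH] H.
  have [z z0] := zero_ex T; exists z; first exact: compacts_zero.
  by split=> //; exact: (tri_zero (prime_tri (svalP P))).
have [|z cz [Pz zs]] := IH; first by move=> W Ws; apply: H; rewrite inE Ws orbT.
have [[x cx VE] VP] := H V (mem_head _ _).
have [w [cw wP]] := thick_sum cz cx.
exists w => //; split.
  apply/wP; first exact/prime_thick/svalP.
  by split=> //; apply: contrapT; move: VP; rewrite -VE.
move=> Q /wP[|Qz Qx W]; first exact/prime_thick/svalP.
rewrite inE => /orP[/eqP ->|]; last exact: zs.
by rewrite -VE => /(_ Qx).
Qed.

Lemma spc_base (U : set (Spc T)) (P : Spc T) : open U -> U P ->
  exists2 z, compacts z & sval P z /\ ~` supp z `<=` U.
Proof.
move=> [D' D'sub <-] [V D'V PV]; have [F FD FV] := D'sub _ D'V.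
pose s : seq (set (Spc T)) := finmap.enum_fset F.
have [|z cz [Pz zs]] := @spc_base_seq s P.
  move=> W Ws; split; first exact: set_mem (FD _ Ws).
  by move: PV; rewrite -FV => /(_ W Ws).
exists z => //; split=> // Q /contrapT /zs Qs; exists V => //.
exact: (eq_ind _ (fun A : set (Spc T) => A Q) (fun W WF => Qs W WF) _ FV).
Qed.

(** Each point off the closed set [Z] avoids the support of some compact object whose support
    contains [Z]. Finitely many of these supports suffice by compactness, and the tensor product of
    the objects has the intersection as its support. *)
Lemma thomason_supp (Y : set (Spc T)) (P : Spc T) : thomason Y -> Y P ->
  exists z, [/\ compacts z, supp z P & supp z `<=` Y].
Proof.
move=> [F [FP ->]] [Z FZ ZP]; have [Zc cZ] := FP _ FZ.
pose good z := compacts z /\ supp z P.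
(* The filter of good objects with eventually small support, directed by tensor products; it stands
   in for the choice of a finite subcover. *)
pose G : set_system T := [set A | exists2 z0, good z0 &
  forall z, good z -> ~` supp z0 `<=` ~` supp z -> A z].
have one_good : good 𝟙.
  by split; [exact: compacts_unit|exact: prime_proper (svalP P)].
have GF : Filter G.
  split.
  - by exists 𝟙.
  - move=> A B [a [ca Pa] aA] [b [cb Pb] bB]; exists (a ⊗ b).
      split; first exact: compacts_tens.
      by move/(spc_tens P ca cb) => [].
    move=> z zg zab; split.
      apply: aA zg _ => Q /contrapT Qa; apply: zab => /=; apply.
      by apply/(spc_tens Q ca cb); left.
    apply: bB zg _ => Q /contrapT Qb; apply: zab => /=; apply.
    by apply/(spc_tens Q ca cb); right.
  - by move=> A B AB [a ga aA]; exists a => // z gz /(aA _ gz)/AB.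
have /compact_near_coveringP/(_ T G (fun z Q => sval Q z) GF) := cZ.
have oZ : open (~` Z) by rewrite openC.
case=> [Q ZQ|z0 gz0 /(_ z0 gz0 (@subset_refl _ _)) H].
  have [z cz [Qz zZ]] := spc_base oZ ZQ.
  exists (~` supp z, [set w | good w /\ ~` supp z `<=` ~` supp w]); first split=> /=.
  - apply: open_nbhs_nbhs; split; first exact: open_supp.
    by move/(_ Qz).
  - exists z; last by [].
    by split=> // Pz; have /(_ ZP) := zZ P (fun H => H Pz).
  - by move=> [R w] /= [/contrapT Rz [_ zw]]; apply: contrapT; apply: zw.
case: gz0 => cz0 Pz0; exists z0; split=> // Q Qz0; exists Z => //.
by apply: contrapT => /H /Qz0.
Qed.

End ThickIdeals.

(** * Idempotent triangles *)

Section LocalizingIdeals.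
Variable T : bigtt.
Implicit Types x y z w : T.

Lemma Loc_ideal (X : set T) : localizing_ideal (Loc X).
Proof.
split; first split; first split.
- by [].
- by move=> z z0 S [[tS _] _] _; exact: (tri_zero tS).
- move=> x y z f g h D _ _ _.
  by split=> Hx Hy S lS XS; have [[tS _] _] := lS;
    have [H1 H2 H3] := tri_two_of_three tS D I I I;
    [apply: H1|apply: H2|apply: H3]; by [exact: Hx|exact: Hy].
- by move=> I X' H S lS XS; apply: (loc_coprod (locid_loc lS)) => i; exact: H.
- by move=> x y H S lS XS; apply: (locid_tens lS); exact: H.
Qed.

Lemma Loc_gen (X : set T) : X `<=` Loc X.
Proof. by move=> x Xx S _ XS; exact: XS. Qed.

Lemma Loc_min (X S : set T) : localizing_ideal S -> X `<=` S -> Loc X `<=` S.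
Proof. by move=> lS XS x; exact. Qed.

Lemma Loc_sub (X X' : set T) : X `<=` Loc X' -> Loc X `<=` Loc X'.
Proof. by move=> XX'; apply: Loc_min XX'; exact: Loc_ideal. Qed.

Lemma locid_iso (S : set T) x y : localizing_ideal S -> isomorphic x y -> S x -> S y.
Proof. by move=> [lS _]; exact: loc_iso lS. Qed.

Lemma locid_zero (S : set T) x : localizing_ideal S -> is_zero x -> S x.
Proof. by move=> [lS _]; exact: loc_zero lS. Qed.

Lemma locid_tensr (S : set T) x y : localizing_ideal S -> S x -> S (x ⊗ y).
Proof.
by move=> lS Sx; apply: (locid_iso lS (tensC y x)); exact: (locid_tens lS).
Qed.

Lemma localizing_ideal_tensr (S : set T) w :
  localizing_ideal S -> localizing_ideal [set s | S (s ⊗ w)].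
Proof.
move=> lS; split.
  by apply: (localizing_preimage _ (tensr_exact w) (@tensr_coprod T w)) (locid_loc lS).
move=> x y /= Sx; apply: (locid_iso lS (isomorphic_sym (tensA y x w))).
exact: (locid_tens lS).
Qed.

Lemma localizing_ideal_zero : localizing_ideal (@is_zero T).
Proof.
split; first exact: localizing_is_zero.
by move=> x y; exact: tens_zerol.
Qed.

Lemma ann_ideal w : localizing_ideal [set s | is_zero (s ⊗ w)].
Proof. exact/localizing_ideal_tensr/localizing_ideal_zero. Qed.

End LocalizingIdeals.

Lemma geometric_preimage_ideal (T T' : bigtt) (f : geometric T T') (S : set T') :
  localizing_ideal S -> localizing_ideal [set x | S (f x)].
Proof.
move=> lS; split.
  by apply: (localizing_preimage _ (geo_exact f) (geo_coprod (g := f))) (locid_loc lS).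
move=> x y /= Sx; have [m _] := geo_monoidal f.
apply: (locid_iso lS (x := f y ⊗ f x)); first by constructor; exact: m.
exact: (locid_tens lS).
Qed.

Section IdempotentTriangles.
Variable T : bigtt.
Implicit Types x y z w : T.
Let M := tt_mon T.

Definition compact_supp (Y : set (Spc T)) : set T :=
  [set x | compacts x /\ supp x `<=` Y].

Lemma compact_supp_tens Y x z : compact_supp Y z -> compacts x -> compact_supp Y (z ⊗ x).
Proof.
move=> [cz zY] cx; split; first exact: compacts_tens.
by move=> P Px; apply: zY => Pz; apply/Px/(spc_tens P cz cx); left.
Qed.

Lemma compact_supp_iso Y x z : isomorphic x z -> compact_supp Y x -> compact_supp Y z.
Proof.
move=> xz [cx xY]; split; first exact: compacts_iso xz cx.
by move=> P Pz; apply: xY => Px; apply/Pz/(thick_iso (prime_thick (svalP P)) xz).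
Qed.

Lemma compact_supp_shift_stable Y : shift_stable (compact_supp Y).
Proof.
split=> [c [cc cY]|c [cc cY]].
  split; first exact: (iffLR (compacts_shift _)).
  move=> P Pc; apply: cY => Pc'; apply: Pc.
  exact: (iffLR (thick_shift (prime_thick (svalP P)) cc)).
have [a a_c] := shift_surj c; exists a; split=> //.
have ca : compacts a.
  by apply/compacts_shift; exact: compacts_iso (isomorphic_sym a_c) cc.
split=> // P Pa; apply: cY => Pc; apply/Pa/(thick_shift (prime_thick (svalP P)) ca).
exact: (thick_iso (prime_thick (svalP P)) (isomorphic_sym a_c)).
Qed.

(* [idm z] factors through [idm z ⊗m ev], and [ev ⊗m idm w] is a morphism from
   an object of the form [z ⊗ s] to [w]. *)
Lemma tens_zero_of_orthogonal z w : compacts z ->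
  (forall s (h : hom (z ⊗ s) w), h = 0) -> is_zero (z ⊗ w).
Proof.
move=> /compact_rigid/rigid_dual[y [ev [coev zy]]] H.
have ev0 : ev ⊗m idm w = 0.
  have [a] : isomorphic (z ⊗ (y ⊗ w)) ((y ⊗ z) ⊗ w).
    exact: isomorphic_trans (tensCA _ _ _) (isomorphic_sym (tensA _ _ _)).
  apply: (@iso_injr _ _ _ _ a); apply: (@iso_injl _ _ _ _ (lunit M w)).
  by rewrite [LHS](H (y ⊗ w)) comp0m compm0.
have zev0 : (idm z ⊗m ev) ⊗m idm w = 0.
  apply: (@iso_injl _ _ _ _ (tassoc M z 𝟙 w)).
  by rewrite tassoc_nat ev0 [idm z ⊗m 0](fmap0 _ _ (tensl_exact z).1) comp0m compm0.
apply/is_zeroP; rewrite -(tensm_id M) -(dual_zigzag zy) !tensmr_comp zev0.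
by rewrite compm0 !comp0m.
Qed.

Lemma idempotent_triangle_zero Y (e f : T) z :
  idempotent_triangle Y e f -> compact_supp Y z -> is_zero (z ⊗ f).
Proof.
move=> [a [b [c [_ _ H]]]] zY; apply: tens_zero_of_orthogonal; first by case: zY.
move=> s h; apply: H; apply: (locid_tensr _ (Loc_ideal _)); exact: Loc_gen.
Qed.

Lemma idempotent_triangle_ann Y (e f : T) :
  idempotent_triangle Y e f -> Loc_supp Y `<=` [set s | is_zero (s ⊗ f)].
Proof.
move=> ef; apply: Loc_min; first exact: ann_ideal.
by move=> z zY; exact: idempotent_triangle_zero ef zY.
Qed.

(** Since [f ⊗ e] vanishes, a map into [f] is zero once its image in [f ⊗ f] is. For [h : y -> f]
    that image factors through [h ⊗m idm f], whose source [y ⊗ f] is zero. *)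
Lemma idempotent_triangleI Y (e f : T) (a : hom e 𝟙) (b : hom 𝟙 f) c :
  dist a b c -> Loc_supp Y e -> (forall z, compact_supp Y z -> is_zero (z ⊗ f)) ->
  idempotent_triangle Y e f.
Proof.
move=> D Ye H; exists a, b, c; split=> // y Yy h.
have Yf : Loc_supp Y `<=` [set s | is_zero (s ⊗ f)].
  by apply: Loc_min; [exact: ann_ideal|exact: H].
have fe0 : is_zero (f ⊗ e) by apply: is_zero_iso (tensC _ _) (Yf _ Ye).
have [c' D'] := exact_dist (tensl_exact f) D.
apply: (@iso_injl _ _ _ _ (iso_sym (runit M f))); rewrite compm0 /=.
have [|k ->] := dist_kernel (k := bwd (runit M f) ∘ h) D'.
  rewrite (bwd_runit_nat M) compA /= -(tensm_exchange M).
  have -> : h ⊗m idm f = 0 by exact: (Yf _ Yy _).2.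
  by rewrite !comp0m.
by rewrite [k](fe0 _).1 compm0.
Qed.

Lemma idempotent_triangle_ex (Y : set (Spc T)) :
  exists e f : T, idempotent_triangle Y e f.
Proof.
have [J [G [Gc Gg]]] := tt_generated T.
have [K [C CP]] := compact_ess_small Gc Gg.
(* Essential smallness of the compact objects is used here: the cells must be indexed by a small
   type. *)
pose K' := {k : K | compact_supp Y (C k)}; pose C' (k : K') := C (sval k).
have C'P z : compact_supp Y z -> exists k, isomorphic (C' k) z.
  move=> zY; have [k kz] := CP _ zY.1.
  by exists (exist _ k (compact_supp_iso (isomorphic_sym kz) zY)).
have [|k|X [e [f [_ [p [q [r [_ eL _ D fP]]]]]]]] :=
    @cellular_perp T (tt_cop T) K' C' _ 𝟙.
- by move=> [k []].
- have [z [zY zk]] := (compact_supp_shift_stable Y).2 _ (svalP k).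
  have [k' k'z] := C'P _ zY; exists k'; apply: isomorphic_trans zk.
  by case: k'z => a; constructor; exact: (fmap_iso _ a).
exists e, f; apply: (idempotent_triangleI D).
  apply: eL; first exact: locid_loc (Loc_ideal _).
  by move=> [k kY]; exact: Loc_gen.
have fY : right_perp (compact_supp Y) f.
  by move=> z /C'P[k kz]; apply: (hom_iso_zero kz) => h; exact: fP.
move=> z zY; apply: tens_zero_of_orthogonal; first by case: zY.
(* The objects [s] with [z ⊗ s] in [L] form a localizing class containing the generators, hence all
   objects; so every map from [z ⊗ s] to [f] is zero. *)
pose L := left_perp (right_perp (compact_supp Y)).
have lL : localizing (tt_cop T) L.
  exact/left_perp_localizing/right_perp_shift_stable/compact_supp_shift_stable.
have H := localizing_preimage (tt_cop T) (tensl_exact z) (@tensl_coprod T z) lL.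
move=> s; apply: (Gg _ H _ s f fY) => j w wY.
exact/wY/compact_supp_tens/Gc.
Qed.

Lemma idempotent_triangle_loc Y (e f : T) (L : set T) w : localizing_ideal L ->
  idempotent_triangle Y e f -> L (w ⊗ e) -> L (w ⊗ f) -> L w.
Proof.
move=> lL [a [b [c [D _ _]]]] Le Lf; apply: (locid_iso lL (tens1r w)).
have [c' D'] := exact_dist (tensl_exact w) D.
have [_ _ H] := tri_two_of_three (loc_tri (locid_loc lL)) D' I I I.
exact: H.
Qed.

(** The consequence of being Thomason on which the comparisons rely. It passes to preimages under
    [Spc_map] without any topology. *)
Definition supp_union (Y : set (Spc T)) : Prop :=
  forall P, Y P -> exists z, compact_supp Y z /\ supp z P.

Lemma thomason_supp_union Y : thomason Y -> supp_union Y.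
Proof. by move=> tY P /(thomason_supp tY)[z [cz zP zY]]; exists z. Qed.

(* With [W = e1 ⊗ f2], both [W ⊗ f1'] and [W ⊗ e2'] vanish. *)
Lemma idempotent_compare (Y1 Y2 Y1' Y2' : set (Spc T))
    (e1 f1 e2 f2 e1' f1' e2' f2' : T) :
  idempotent_triangle Y1 e1 f1 -> idempotent_triangle Y2 e2 f2 ->
  idempotent_triangle Y1' e1' f1' -> idempotent_triangle Y2' e2' f2' ->
  supp_union Y2 -> supp_union Y1' ->
  Y1 `&` ~` Y2 `<=` Y1' `&` ~` Y2' -> Loc [set e1' ⊗ f2'] (e1 ⊗ f2).
Proof.
move=> t1 t2 t1' t2' u2 u1' YY.
have e1Y : Loc_supp Y1 e1 by case: t1 => a [b [c []]].
have e2Y' : Loc_supp Y2' e2' by case: t2' => a [b [c []]].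
have lL := Loc_ideal [set e1' ⊗ f2'].
have Wf : is_zero ((e1 ⊗ f2) ⊗ f1').
  apply: is_zero_iso (tensA _ _ _) _.
  apply: (Loc_min (ann_ideal (f2 ⊗ f1')) _ e1Y) => z [cz zY].
  (* A point of the support of [z] lies in [Y2] or in [Y1']. A compact object supported there and
     nonzero at the point annihilates [f2] or [f1'], respectively. *)
  suff [] : [set z | compacts z /\ is_zero (z ⊗ (f2 ⊗ f1'))] z by [].
  apply: (thick_supp (thick_annihilator _) cz) => P /zY Y1P.
  have [Y2P|NY2P] := EM (Y2 P).
    have [a [aY aP]] := u2 _ Y2P; exists a => //; split; first by case: aY.
    apply: is_zero_iso (isomorphic_sym (tensA _ _ _)) _.
    by apply: tens_zeror; exact: idempotent_triangle_zero t2 aY.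
  have [Y1'P _] := YY P (conj Y1P NY2P).
  have [a [aY aP]] := u1' _ Y1'P; exists a => //; split; first by case: aY.
  apply: is_zero_iso (tensCA _ _ _) _.
  by apply: tens_zerol; exact: idempotent_triangle_zero t1' aY.
have We : is_zero ((e1 ⊗ f2) ⊗ e2').
  apply: is_zero_iso (tensC _ _) _.
  apply: (Loc_min (ann_ideal (e1 ⊗ f2)) _ e2Y') => z' [cz' zY'] /=.
  apply: is_zero_iso (tensCA _ _ _) _.
  apply: (Loc_min (ann_ideal (z' ⊗ f2)) _ e1Y) => z [cz zY] /=.
  apply: is_zero_iso (isomorphic_sym (tensA _ _ _)) _.
  apply: (idempotent_triangle_zero t2); split; first exact: compacts_tens.
  move=> P Pzz'; apply: contrapT => NY2P.
  have Y1P : Y1 P by apply: zY => Pz; apply/Pzz'/(spc_tens P cz cz'); left.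
  have [_] := YY P (conj Y1P NY2P); apply.
  by apply: zY' => Pz; apply/Pzz'/(spc_tens P cz cz'); right.
(* Both triangles decompose [W]; the only piece that does not vanish is [(W ⊗ e1') ⊗ f2']. *)
apply: (idempotent_triangle_loc lL t1'); last exact: (locid_zero lL).
apply: (idempotent_triangle_loc lL t2').
  apply: (locid_zero lL); apply: is_zero_iso (tensA _ _ _) _.
  apply: is_zero_iso (tens_isol _ (tensC _ _)) _.
  apply: is_zero_iso (isomorphic_sym (tensA _ _ _)) _.
  exact: tens_zeror.
apply: (locid_iso lL (isomorphic_sym (tensA _ _ _))).
by apply: (locid_tens lL); exact: Loc_gen.
Qed.

Lemma idempotent_zero (Y1 Y2 : set (Spc T)) (e1 f1 e2 f2 : T) :
  idempotent_triangle Y1 e1 f1 -> idempotent_triangle Y2 e2 f2 ->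
  Y1 `<=` Y2 -> is_zero (e1 ⊗ f2).
Proof.
move=> [a [b [c [_ e1Y _]]]] t2 YY; apply: (idempotent_triangle_ann t2).
apply: Loc_sub e1Y => z [cz zY]; apply: Loc_gen; split=> //.
exact: subset_trans YY.
Qed.

End IdempotentTriangles.

(** The objects [f v], with [v] supported in [Y], need not be all compact objects supported in the
    preimage. Their supports cover it, though, and each annihilates [f w], so [thick_supp] applies
    to the annihilator of [f w]. *)
Lemma idempotent_image (T T' : bigtt) (f : geometric T T') (Y : set (Spc T))
    (e w : T) : supp_union Y ->
  idempotent_triangle Y e w ->
  idempotent_triangle (Spc_map f @^-1` Y) (f e) (f w).
Proof.
move=> uY ew; have [a [b [c [D eY _]]]] := ew.
have [m [i _]] := geo_monoidal f.
have [c' D'] := exact_dist (geo_exact f) D.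
have {}D' : dist (bwd i ∘ fmap f a) (fmap f b ∘ i) c'.
  apply: (@dist_iso _ _ _ _ _ _ _ _ _ _ _ _ _ (iso_refl _) (iso_sym i)
    (iso_refl _) _ _ _ D') => /=.
  - by rewrite compm1.
  - by rewrite comp1m -compA bwdK compm1.
  - by rewrite fmap_id comp1m compm1.
have suppE (Q : Spc T') z : compacts z -> supp (f z) Q <-> supp z (Spc_map f Q).
  by move=> cz; split=> H; [case=> _; exact: H|move=> Qz; exact: H].
apply: (idempotent_triangleI D').
  apply: (Loc_min (geometric_preimage_ideal f (Loc_ideal _)) _ eY) => z [cz zY].
  apply: Loc_gen; split; first exact: geometric_compacts.
  by move=> Q /(suppE _ _ cz)/zY.
move=> z [cz zY].
suff [] : [set z | compacts z /\ is_zero (z ⊗ f w)] z by [].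
apply: (thick_supp (thick_annihilator _) cz) => Q /zY/uY[v [vY vQ]].
exists (f v); last by apply/(suppE _ _ vY.1).
split; first by apply: geometric_compacts; case: vY.
apply: (@is_zero_iso _ _ (f (v ⊗ w))); first by constructor; exact: m.
exact/(exact_zero (geo_exact f))/(idempotent_triangle_zero ew).
Qed.

(** * The projection formula *)

Section StrongMonoidal.
Variables (C D : category) (M : sym_monoidal C) (N : sym_monoidal D).
Variables (F : functor C D)
  (m : forall x y, iso (tens N (F x) (F y)) (F (tens M x y)))
  (e : iso (tunit N) (F (tunit M))).
Hypotheses
  (m_nat : forall (x x' y y' : C) (f : hom x x') (g : hom y y'),
    m x' y' ∘ tensm N (fmap F f) (fmap F g) = fmap F (tensm M f g) ∘ m x y)
  (m_assoc : forall x y z : C,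
    fmap F (tassoc M x y z) ∘ m (tens M x y) z ∘ tensm N (m x y) (idm (F z))
    = m x (tens M y z) ∘ tensm N (idm (F x)) (m y z) ∘ tassoc N (F x) (F y) (F z))
  (m_lunit : forall x : C,
    fmap F (lunit M x) ∘ m (tunit M) x ∘ tensm N e (idm (F x)) = lunit N (F x))
  (m_runit : forall x : C,
    fmap F (runit M x) ∘ m x (tunit M) ∘ tensm N (idm (F x)) e = runit N (F x)).

(** Here and below the coherence of [m] is oriented as rewriting rules that end in the inverse of
    [m], so that in a composite neighbouring copies of [m] and its inverse cancel by [isoK]. *)
Lemma fmap_runit x : fmap F (runit M x) =
  runit N (F x) ∘ (tensm N (idm (F x)) (bwd e) ∘ bwd (m x (tunit M))).
Proof.
apply: (@iso_injr _ _ _ _ (m x (tunit M))); rewrite -!compA fwdK compm1.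
by rewrite -m_runit -compA -tensml_comp bwdK tensm_id compm1.
Qed.

Lemma fmap_lunit x : fmap F (lunit M x) =
  lunit N (F x) ∘ (tensm N (bwd e) (idm (F x)) ∘ bwd (m (tunit M) x)).
Proof.
apply: (@iso_injr _ _ _ _ (m (tunit M) x)); rewrite -!compA fwdK compm1.
by rewrite -m_lunit -compA -tensmr_comp bwdK tensm_id compm1.
Qed.

Lemma fmap_bwd (x y : C) (a : iso x y) (b : hom (F y) (F x)) :
  fmap F a ∘ b = idm _ -> fmap F (bwd a) = b.
Proof.
move=> E; apply: (@iso_injl _ _ _ _ (fmap_iso F a)).
by rewrite /= E -fmap_comp bwdK fmap_id.
Qed.

Lemma fmap_bwd_lunit x : fmap F (bwd (lunit M x)) =
  m (tunit M) x ∘ (tensm N e (idm (F x)) ∘ bwd (lunit N (F x))).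
Proof. by apply: fmap_bwd; rewrite !compA m_lunit bwdK. Qed.

Lemma fmap_bwd_runit x : fmap F (bwd (runit M x)) =
  m x (tunit M) ∘ (tensm N (idm (F x)) e ∘ bwd (runit N (F x))).
Proof. by apply: fmap_bwd; rewrite !compA m_runit bwdK. Qed.

Lemma fmap_tensl x y z (h : hom y z) : fmap F (tensm M (idm x) h) =
  m x z ∘ (tensm N (idm (F x)) (fmap F h) ∘ bwd (m x y)).
Proof.
by rewrite compA -fmap_id m_nat -compA bwdK compm1.
Qed.

Lemma fmap_tensr x y z (h : hom y z) : fmap F (tensm M h (idm x)) =
  m z x ∘ (tensm N (fmap F h) (idm (F x)) ∘ bwd (m y x)).
Proof.
by rewrite compA -fmap_id m_nat -compA bwdK compm1.
Qed.

Lemma fmap_tassoc x y z : fmap F (tassoc M x y z) =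
  m x (tens M y z) ∘ (tensm N (idm (F x)) (m y z) ∘ (tassoc N (F x) (F y) (F z)
    ∘ (tensm N (bwd (m x y)) (idm (F z)) ∘ bwd (m (tens M x y) z)))).
Proof.
apply: (@iso_injr _ _ _ _ (m (tens M x y) z)); rewrite -!compA fwdK compm1.
rewrite [RHS]compA [RHS]compA -m_assoc -!compA -tensmr_comp bwdK.
by rewrite tensm_id compm1.
Qed.

Lemma fmap_bwd_tassoc x y z : fmap F (bwd (tassoc M x y z)) =
  m (tens M x y) z ∘ (tensm N (m x y) (idm (F z)) ∘ (bwd (tassoc N (F x) (F y) (F z))
    ∘ (tensm N (idm (F x)) (bwd (m y z)) ∘ bwd (m x (tens M y z))))).
Proof.
apply: fmap_bwd; rewrite [LHS]compA [LHS]compA m_assoc -!compA isoKV.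
by rewrite [X in _ ∘ X]compA -tensml_comp bwdK tensm_id comp1m bwdK.
Qed.

(** Unlike [rigid_image], this keeps the evaluation and coevaluation visible, as the comparison of
    transposes in [fmap_transposeL] requires. *)
Lemma dual_pair_image (x y : C) (ev : hom (tens M y x) (tunit M))
    (coev : hom (tunit M) (tens M x y)) :
  dual_pair ev coev ->
  dual_pair (M := N) (bwd e ∘ (fmap F ev ∘ m y x))
    (bwd (m x y) ∘ (fmap F coev ∘ e)).
Proof.
move=> xy; split.
  have := congr1 (fmap F) (dual_zigzag xy).
  rewrite !fmap_comp fmap_runit fmap_tensl fmap_tassoc fmap_tensr fmap_bwd_lunit.
  by rewrite fmap_id -!compA !isoK !tensml_comp !tensmr_comp -!compA.
have := congr1 (fmap F) (dual_zagzig xy).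
rewrite !fmap_comp fmap_lunit fmap_tensl fmap_bwd_tassoc fmap_tensr fmap_bwd_runit.
by rewrite fmap_id -!compA !isoK !tensml_comp !tensmr_comp -!compA.
Qed.

Lemma fmap_transposeL (x y z b : C) (ev : hom (tens M y x) (tunit M))
    (coev : hom (tunit M) (tens M x y)) (v : hom (tens M y z) b) :
  bwd (m x b) ∘ fmap F (transposeL coev v) =
  transposeL (M := N) (bwd (m x y) ∘ (fmap F coev ∘ e)) (fmap F v ∘ m y z).
Proof.
rewrite /transposeL !fmap_comp fmap_tensl fmap_tassoc fmap_tensr fmap_bwd_lunit.
by rewrite -!compA !isoK !tensml_comp !tensmr_comp -!compA.
Qed.

End StrongMonoidal.

(** * Right adjoints tested on compact objects *)

Lemma counit_ex (C D : category) (F : functor C D) (G : functor D C) :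
  is_right_adjoint F G -> exists eps : forall s, hom (F (G s)) s,
    (forall x s, bijective (fun u : hom x (G s) => eps s ∘ fmap F u)) /\
    (forall s t (v : hom s t), v ∘ eps s = eps t ∘ fmap F (fmap G v)).
Proof.
move=> [phi [phib phil phir]].
have /all_tag[eps epsE] s : {k | phi (G s) s k = idm (G s)} by exact/cid/bij_surj.
exists eps; split=> [x s|s t v].
  have [psi phiK psiK] := phib x s; exists (phi x s) => [u|k].
    by rewrite phil epsE comp1m.
  by apply: (bij_inj (phib x s)); rewrite phil epsE comp1m.
by apply: (bij_inj (phib _ _)); rewrite phir phil !epsE compm1 comp1m.
Qed.

(** The cone of [k] receives no nonzero map from a compact object, so it is zero. *)
Lemma iso_of_compacts (T : bigtt) (x y : T) (k : hom x y) :
  (forall c : T, compacts c -> bijective (fun u : hom c x => k ∘ u)) ->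
  exists a : iso x y, a = k :> hom x y.
Proof.
move=> kb; have [z [q [h D]]] := dist_cone k.
apply: (dist_iso_of_zero D); have [J [G [Gc Gg]]] := tt_generated T.
apply: (generators_detect (S := tt_cop T) (compact_shift_stable (tt_cop T))).
  by move=> L lL CL; apply: Gg => // j; exact/CL/Gc.
move=> c cc w.
have hw : h ∘ w = 0.
  have [c' [a]] := shift_surj c; apply: (@iso_injr _ _ _ _ a); rewrite comp0m.
  have cc' : compacts c'.
    by apply/compacts_shift; apply: compacts_iso cc; constructor; exact: iso_sym a.
  have [v vE] := shift_full (h ∘ w ∘ a); rewrite -vE.
  suff -> : v = 0 by rewrite fmap0//; exact: shift_additive.
  apply: (bij_inj (kb _ cc')); rewrite compm0; apply: shift_inj.
  rewrite fmap_comp vE !compA (dist_comp0'' D) !comp0m.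
  by rewrite fmap0//; exact: shift_additive.
have [w' ->] := dist_kernel' D hw.
by have [w'' <-] := bij_surj (kb c cc) w'; rewrite compA (dist_comp0 D) comp0m.
Qed.

Section Adjoint.
Variables (T S : bigtt) (f : geometric T S) (g : functor S T).

(* [k : f a -> b] exhibits [a] as the value at [b] of the right adjoint of [f],
   as seen by compact objects. *)
Definition universal (a : T) (b : S) (k : hom (f a) b) : Prop :=
  forall c : T, compacts c -> bijective (fun u : hom c a => k ∘ fmap f u).

Lemma universal_iso (a a' : T) (b b' : S) (k : hom (f a) b) (al : iso a' a)
  (be : iso b b') : universal k -> universal (be ∘ k ∘ fmap f al).
Proof.
move=> ku c cc; have [k' k'K kK'] := ku _ cc.
exists (fun v => bwd al ∘ k' (bwd be ∘ v)) => u.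
  by rewrite -!compA isoK -fmap_comp k'K isoK.
by rewrite -!compA -fmap_comp isoKV kK' isoKV.
Qed.

Lemma universal_zero (a : T) (b : S) (k : hom (f a) b) :
  is_zero a -> is_zero b -> universal k.
Proof.
move=> a0 b0 c _; exists (fun=> 0) => u; first by rewrite [u](a0 _).1.
by rewrite [u](b0 _).1 [LHS](b0 _).1.
Qed.

Lemma universal_shift (a : T) (b : S) (k : hom (f a) b)
    (s : forall x : T, iso (f (shift x)) (shift (f x))) :
  (forall (x y : T) (h : hom x y),
      s y ∘ fmap f (fmap shift h) = fmap shift (fmap f h) ∘ s x) ->
  universal k -> universal (fmap shift k ∘ s a).
Proof.
move=> sN ku c cc; have [c' [al]] := shift_surj c.
have cc' : compacts c'.
  by apply/compacts_shift; apply: compacts_iso cc; constructor; exact: iso_sym al.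
have E (u0 : hom c' a) :
    fmap shift k ∘ s a ∘ fmap f (fmap shift u0 ∘ bwd al) =
    fmap shift (k ∘ fmap f u0) ∘ s c' ∘ fmap f (bwd al).
  by rewrite !fmap_comp !compA; congr (_ ∘ _); rewrite -compA sN compA.
have lift (u : hom c (shift a)) : exists u0, u = fmap shift u0 ∘ bwd al.
  have [u0 u0E] := shift_full (u ∘ al); exists u0.
  by rewrite u0E -compA bwdK compm1.
apply: inj_surj_bij => [u v|w].
  have [u0 ->] := lift u; have [v0 ->] := lift v; rewrite !E => EE.
  congr (fmap _ _ ∘ _); apply: (bij_inj (ku _ cc')); apply: shift_inj.
  apply: (@iso_injr _ _ _ _ (s c')).
  exact: (@iso_injr _ _ _ _ (fmap_iso f (iso_sym al))).
have [w0 w0E] := shift_full (w ∘ fmap f al ∘ bwd (s c')).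
have [u0 u0E] := bij_surj (ku _ cc') w0.
exists (fmap shift u0 ∘ bwd al); rewrite E u0E w0E -!compA isoK.
by rewrite -fmap_comp bwdK fmap_id compm1.
Qed.

(** The comparisons at the shifts are arguments because [adjoint_dist] and [proj_map_universal]
    supply different ones. *)
Lemma universal_cone (x y z : T) (u : hom x y) (v : hom y z) (w : hom z (shift x))
    (x' y' z' : S) (u' : hom x' y') (v' : hom y' z') (w' : hom z' (shift x'))
    (kx : hom (f x) x') (ky : hom (f y) y') (kz : hom (f z) z')
    (ksx : hom (f (shift x)) (shift x')) (ksy : hom (f (shift y)) (shift y')) :
  dist u v w -> dist u' v' w' ->
  ky ∘ fmap f u = u' ∘ kx -> kz ∘ fmap f v = v' ∘ ky ->
  ksx ∘ fmap f w = w' ∘ kz ->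
  ksy ∘ fmap f (fmap shift u) = fmap shift u' ∘ ksx ->
  universal kx -> universal ky -> universal ksx -> universal ksy ->
  universal kz.
Proof.
move=> D D' Eu Ev Ew Es bx by_ bsx bsy c cc.
have fD := exact_additive (geo_exact f).
apply: (five_hom D D' _ _ _ _ _ _ _ (bx c cc) (by_ c cc) (bsx c cc) (bsy c cc)) => /=.
- by move=> k; rewrite fmap_comp !compA Eu.
- by move=> k; rewrite fmap_comp !compA Ev.
- by move=> k; rewrite fmap_comp !compA Ew.
- by move=> k; rewrite fmap_comp !compA Es.
- by move=> k l; rewrite fD compDr.
- by rewrite (fmap0 _ _ fD) compm0.
- by rewrite (fmap0 _ _ fD) compm0.
Qed.

Lemma universal_coproduct (I : small) (X : I -> T) (a : T)
    (j : forall i, hom (X i) a) (Y : I -> S) (b : S) (j' : forall i, hom (Y i) b)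
    (ki : forall i, hom (f (X i)) (Y i)) (k : hom (f a) b) :
  is_coproduct j -> is_coproduct j' ->
  (forall i, k ∘ fmap f (j i) = j' i ∘ ki i) ->
  (forall i, universal (ki i)) -> universal k.
Proof.
move=> jP jP' kj ku c cc; have fD := exact_additive (geo_exact f).
apply: (coproduct_bij (ti := fun i (u : hom c (X i)) => ki i ∘ fmap f u) cc
  (geometric_compacts (f := f) cc) jP jP') => [u v|i u|i].
- by rewrite fD compDr.
- by rewrite fmap_comp !compA kj.
- exact: ku.
Qed.

Hypothesis adj : is_right_adjoint f g.

Lemma universal_adjoint (a : T) (b : S) (k : hom (f a) b)
    (eps : forall s, hom (f (g s)) s) :
  (forall x s, bijective (fun u : hom x (g s) => eps s ∘ fmap f u)) ->
  universal k -> exists al : iso a (g b), eps b ∘ fmap f al = k.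
Proof.
move=> epsb ku; have [al alE] := bij_surj (epsb a b) k.
have [c cc|al' al'E] := iso_of_compacts (k := al); last by exists al'; rewrite al'E.
have [l lK Kl] := epsb c b; have [k' k'K kK'] := ku c cc.
exists (fun u => k' (eps b ∘ fmap f u)) => u.
  by rewrite fmap_comp compA alE k'K.
by apply: (bij_inj (epsb c b)); rewrite fmap_comp compA alE kK'.
Qed.

Lemma adjoint_zero (s : S) : is_zero s -> is_zero (g s).
Proof.
have [eps [epsb _]] := counit_ex adj.
move=> s0; apply/is_zeroP/(bij_inj (epsb _ s)).
by rewrite [LHS](s0 _).1 [RHS](s0 _).1.
Qed.

(** Complete [fmap g u] to a triangle, apply [f], and fill with counits. The filler is universal by
    the five lemma, which identifies the third object with [g t]. *)
Lemma adjoint_dist (r s t : S) (u : hom r s) (v : hom s t) (w : hom t (shift r)) :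
  dist u v w -> exists w', dist (fmap g u) (fmap g v) w'.
Proof.
move=> D; have [eps [epsb epsN]] := counit_ex adj.
have [z [q [h D1]]] := dist_cone (fmap g u).
have [fD [sg [sgN sgD]]] := geo_exact f.
have [|k [kq kh]] := dist_fill (a := eps r) (b := eps s) (sgD _ _ _ _ _ _ D1) D.
  by rewrite epsN.
have epsu x : universal (eps x) by move=> c _; exact: epsb.
have ku : universal k.
  apply: (universal_cone D1 D (kx := eps r) (ky := eps s)
    (ksx := fmap shift (eps r) ∘ sg _) (ksy := fmap shift (eps s) ∘ sg _)) => //.
  - by rewrite -compA kh.
  - by rewrite -compA sgN !compA -!fmap_comp epsN.
  - exact: universal_shift.
  - exact: universal_shift.
have [al alE] := universal_adjoint epsb ku.
exists (h ∘ bwd al); have -> : fmap g v = al ∘ q.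
  by apply: (bij_inj (epsb _ _)); rewrite fmap_comp compA alE kq epsN.
exact: dist_isoz.
Qed.

(** The right adjoint preserves coproducts because [f] preserves compact objects. *)
Lemma adjoint_coprod (I : small) (X : I -> S) :
  isomorphic (coprod (tt_cop T) (g \o X)) (g (coprod (tt_cop S) X)).
Proof.
have [eps [epsb epsN]] := counit_ex adj.
have jP := coprodP (tt_cop T) (g \o X); have jP' := coprodP (tt_cop S) X.
have [k [kE _]] := jP _ (fun i => fmap g (inj (tt_cop S) X i)).
have ku : universal (eps (coprod (tt_cop S) X) ∘ fmap f k).
  apply: (universal_coproduct jP jP' (ki := fun i => eps (X i))).
    by move=> i; rewrite -compA -fmap_comp kE epsN.
  by move=> i c _; exact: epsb.
by have [al _] := universal_adjoint epsb ku; constructor.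
Qed.

Lemma adjoint_preimage_localizing (L : set T) :
  localizing (tt_cop T) L -> localizing (tt_cop S) [set s | L (g s)].
Proof.
move=> lL; split=> [|I X XL].
  split=> // [z z0|x y z u v w /adjoint_dist[w' D] _ _ _].
    exact/(loc_zero lL)/adjoint_zero.
  exact: (tri_two_of_three (loc_tri lL) D).
apply: (loc_iso lL (adjoint_coprod X)); exact: (loc_coprod lL).
Qed.

Section Projection.
Variables (eps : forall s, hom (f (g s)) s).
Hypothesis epsb : forall x s, bijective (fun u : hom x (g s) => eps s ∘ fmap f u).
Variables (m : forall x y, iso (f x ⊗ f y) (f (x ⊗ y))) (e : iso 𝟙 (f 𝟙)).
Hypotheses
  (m_nat : forall (x x' y y' : T) (h : hom x x') (k : hom y y'),
    m x' y' ∘ (fmap f h ⊗m fmap f k) = fmap f (h ⊗m k) ∘ m x y)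
  (m_assoc : forall x y z : T,
    fmap f (tassoc (tt_mon T) x y z) ∘ m (x ⊗ y) z ∘ (m x y ⊗m idm (f z))
    = m x (y ⊗ z) ∘ (idm (f x) ⊗m m y z) ∘ tassoc (tt_mon S) (f x) (f y) (f z))
  (m_lunit : forall x : T,
    fmap f (lunit (tt_mon T) x) ∘ m 𝟙 x ∘ (e ⊗m idm (f x))
    = lunit (tt_mon S) (f x))
  (m_runit : forall x : T,
    fmap f (runit (tt_mon T) x) ∘ m x 𝟙 ∘ (idm (f x) ⊗m e)
    = runit (tt_mon S) (f x)).
Variable s : S.

(** The adjoint mate of the canonical map from [x ⊗ g s] to [g (f x ⊗ s)]. *)
Definition proj_map (x : T) : hom (f (x ⊗ g s)) (f x ⊗ s) :=
  (idm (f x) ⊗m eps s) ∘ bwd (m x (g s)).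

Lemma proj_map_nat (x x' : T) (h : hom x x') :
  proj_map x' ∘ fmap f (h ⊗m idm (g s)) = (fmap f h ⊗m idm s) ∘ proj_map x.
Proof.
rewrite /proj_map (fmap_tensr m_nat) -!compA isoK.
by rewrite [LHS]compA [RHS]compA tensm_exchange.
Qed.

Lemma proj_map_iso (x x' : T) : isomorphic x x' ->
  universal (proj_map x) -> universal (proj_map x').
Proof.
move=> [a] /(universal_iso (iso_sym (fmap_iso (tensr (tt_mon T) (g s)) a))
  (fmap_iso (tensr (tt_mon S) s) (fmap_iso f a))) /=.
rewrite -proj_map_nat -compA -fmap_comp -tensmr_comp bwdK tensm_id fmap_id.
by rewrite compm1.
Qed.

(** Moving [x] to the other side by its dual [y], in [T] and in [S], turns the claim into the
    adjunction bijection at [y ⊗ c]. *)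
Lemma proj_map_compact (x : T) : compacts x -> universal (proj_map x).
Proof.
move=> /compact_rigid/rigid_dual[y [ev [coev xy]]] c _.
have xy' := dual_pair_image m_nat m_assoc m_lunit m_runit xy.
pose t (u : hom c (x ⊗ g s)) := proj_map x ∘ fmap f u.
pose t' (v : hom (y ⊗ c) (g s)) := transposeL (bwd (m x y) ∘ (fmap f coev ∘ e))
  (eps s ∘ fmap f v ∘ m y c).
have tE v : t (transposeL coev v) = t' v.
  rewrite /t /t' /proj_map -compA (fmap_transposeL m_nat m_assoc m_lunit ev).
  by rewrite /transposeL !compA -tensml_comp !compA.
have [k' k'K kK'] := epsb (y ⊗ c) s.
pose r (w : hom (f c) (f x ⊗ s)) :=
  transposeL coev (k' (transposeR (bwd e ∘ (fmap f ev ∘ m y x)) w ∘ bwd (m y c))).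
exists r => [u|w].
  rewrite -[u](transposeLK xy) -/(t _) tE /r /t' (transposeRK xy').
  by rewrite -!compA bwdK compm1 k'K.
rewrite -/(t _) tE /t' kK' -compA fwdK compm1; exact: (transposeLK xy').
Qed.

Lemma proj_map_universal (x : T) : universal (proj_map x).
Proof.
(* Quantifying over compact [r] makes [P] stable under shifts in both directions: one tensors with
   [shift 𝟙] or with a desuspension of the unit, so no compatibility of the tensor product's shift
   isomorphisms in its two variables is involved. *)
pose P : set T := [set x | forall r, compacts r -> universal (proj_map (r ⊗ x))].
have tensS (a b : T) : isomorphic (a ⊗ shift b) (shift (a ⊗ b)).
  exact: (exact_shift (tensl_exact a)).
have Stens (a b : T) : isomorphic (shift a ⊗ b) (shift (a ⊗ b)).
  exact: (exact_shift (tensr_exact b)).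
have [o oE] := shift_surj (𝟙 : T).
have co : compacts o.
  apply/compacts_shift; apply: compacts_iso (isomorphic_sym oE) _.
  exact: compacts_unit.
have Pcompact r x' : P x' -> compacts r -> P (r ⊗ x').
  move=> Px cr r' cr'; apply: (proj_map_iso (tensA _ _ _)).
  by apply: Px; exact: compacts_tens.
have Piso x' y' : isomorphic x' y' -> P x' -> P y'.
  by move=> xy Px r cr; apply: proj_map_iso (Px r cr); exact: tens_isol.
have Pshift x' : P x' -> P (shift x').
  move=> Px; apply: Piso (Pcompact (shift 𝟙) _ Px _).
    apply: isomorphic_trans (Stens _ _) _.
    by have [a] := tens1l x'; constructor; exact: fmap_iso a.
  exact/(iffLR (compacts_shift _))/compacts_unit.
have Pdesusp x' : P (shift x') -> P x'.
  move=> Px; apply: Piso (Pcompact o _ Px co).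
  apply: isomorphic_trans (tensS _ _) _.
  apply: isomorphic_trans (isomorphic_sym (Stens _ _)) _.
  by apply: isomorphic_trans (tens_isor _ oE) (tens1l _).
have Puniv x' : P x' -> universal (proj_map x').
  by move=> Px; apply: proj_map_iso (tens1l x') (Px _ (@compacts_unit T)).
have lP : localizing (tt_cop T) P.
  split; first apply: triangulated_inI.
  - move=> z z0 r cr; have rz0 : is_zero (r ⊗ z) by exact: tens_zerol.
    apply: universal_zero; first exact: tens_zeror.
    exact/tens_zeror/(exact_zero (geo_exact f)).
  - by move=> x'; split; [exact: Pshift|exact: Pdesusp].
  - move=> a b c u v w D Pa Pb r cr.
    have [w1 D1] := exact_dist (tensl_exact r) D.
    have [_ [s1 [s1N s1D]]] := tensr_exact (g s).
    have [_ [s2 [s2N s2D]]] := exact_comp (tensr_exact s) (geo_exact f).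
    have D2 := s1D _ _ _ _ _ _ D1; have D3 := s2D _ _ _ _ _ _ D1.
    (* At the shifts, [proj_map] is conjugated by the shift isomorphisms of the two exact functors
       it connects; the squares then reduce to its naturality. *)
    apply: (universal_cone D2 D3 (kx := proj_map (r ⊗ a)) (ky := proj_map (r ⊗ b))
      (ksx := s2 _ ∘ proj_map (shift (r ⊗ a)) ∘ fmap f (bwd (s1 _)))
      (ksy := s2 _ ∘ proj_map (shift (r ⊗ b)) ∘ fmap f (bwd (s1 _)))) => /=.
    + exact: proj_map_nat.
    + exact: proj_map_nat.
    + rewrite -!compA -fmap_comp isoK /=.
      by rewrite -[in RHS]proj_map_nat /proj_map -!compA.
    + have E : bwd (s1 _) ∘ fmap shift (fmap (tensr (tt_mon T) (g s))
          (fmap (tensl (tt_mon T) r) u)) =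
          fmap (tensr (tt_mon T) (g s)) (fmap shift (fmap (tensl (tt_mon T) r) u))
          ∘ bwd (s1 _).
        apply: (@iso_injl _ _ _ _ (s1 (r ⊗ b))); rewrite isoKV compA s1N.
        by rewrite -compA bwdK compm1.
      rewrite -[LHS]compA -fmap_comp E fmap_comp [LHS]compA.
      rewrite -[X in X ∘ _ = _]compA proj_map_nat [X in X ∘ _ = _]compA.
      rewrite [RHS]compA [X in _ = X ∘ _]compA; congr (_ ∘ _ ∘ _); exact: s2N.
    + exact: Pa.
    + exact: Pb.
    + apply: (universal_iso (iso_sym (s1 _)) (s2 _)).
      apply: Puniv; apply/Pshift/Pcompact => //.
    + apply: (universal_iso (iso_sym (s1 _)) (s2 _)).
      apply: Puniv; apply/Pshift/Pcompact => //.
  - move=> I X PX r cr.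
    have jP := tensl_coprod (x := r) (coprodP (tt_cop T) X).
    apply: (universal_coproduct (tensr_coprod (x := g s) jP)
      (tensr_coprod (x := s) (geo_coprod (g := f) jP))
      (ki := fun i => proj_map (r ⊗ X i))) => i.
      exact: proj_map_nat.
    exact: PX.
have [J [G [Gc Gg]]] := tt_generated T.
apply/Puniv/(Gg _ lP) => j r cr; apply: proj_map_compact.
by apply: compacts_tens cr; exact: Gc.
Qed.

End Projection.
End Adjoint.

Section AdjointIdeals.
Variables (T S : bigtt) (f : geometric T S) (g : functor S T).
Hypothesis adj : is_right_adjoint f g.

Lemma projection_formula (x : T) (s : S) : isomorphic (x ⊗ g s) (g (f x ⊗ s)).
Proof.
have [eps [epsb _]] := counit_ex adj.
have [m [e [m_nat m_assoc m_lunit m_runit]]] := geo_monoidal f.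
have ku := proj_map_universal epsb m_nat m_assoc m_lunit m_runit s x.
by have [al _] := universal_adjoint epsb ku; constructor.
Qed.

Lemma geometric_tens (x y : T) : isomorphic (f x ⊗ f y) (f (x ⊗ y)).
Proof. by have [m _] := geo_monoidal f; constructor; exact: m. Qed.

Lemma adjoint_Loc (X : set T) (s : S) : Loc (f @` X) s -> Loc X (g s).
Proof.
move=> Xs; have lX := Loc_ideal X.
have lg := adjoint_preimage_localizing adj (locid_loc lX).
(* Since [g] is not monoidal, the preimage of an ideal under it need not be one; the quantifier over
   [r] restores closure under tensoring. *)
suff H : localizing_ideal [set s | forall r, Loc X (g (r ⊗ s))].
  apply: (loc_iso lg (tens1l s)); move: (𝟙 : S); apply: (Loc_min H _ Xs).
  move=> _ [y Xy <-] r /=; apply: (loc_iso lg (tensC (f y) r)).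
  apply: (locid_iso lX (projection_formula y r)).
  by apply: (locid_tensr _ lX); exact: Loc_gen.
have lr r := localizing_preimage (tt_cop S) (tensl_exact r) (@tensl_coprod S r) lg.
split; first split; first split=> //.
- by move=> z z0 r; exact: (loc_zero (lr r)).
- move=> x y z u v w D _ _ _.
  by split=> Hx Hy r; have [H1 H2 H3] := tri_two_of_three (loc_tri (lr r)) D I I I;
    [apply: H1|apply: H2|apply: H3]; by [exact: Hx|exact: Hy].
- by move=> I X' H r; apply: (loc_coprod (lr r)) => i; exact: H.
- by move=> x y H r; exact: (loc_iso lg (tensA r y x)) (H _).
Qed.

End AdjointIdeals.

(** * Descent of stratification *)

Section Descent.
Variables (I : small) (T : bigtt) (Ti : I -> bigtt).
Variables (f : forall i, geometric T (Ti i)) (g : forall i, functor (Ti i) T).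
Hypothesis adj : forall i, is_right_adjoint (f i) (g i).
Hypothesis unit_in :
  Loc [set coprod (tt_cop T) (fun i : I => g i (𝟙 : Ti i))] (𝟙 : T).

Lemma joint_descent (L : set T) (x : T) : localizing_ideal L ->
  (forall i, L (g i (f i x))) -> L x.
Proof.
move=> lL H; apply: (locid_iso lL (tens1l x)).
apply: (Loc_min (localizing_ideal_tensr x lL) _ unit_in) => _ -> /=.
apply: (loc_coproduct (locid_loc lL)
  (tensr_coprod (x := x) (coprodP (tt_cop T) (fun i => g i 𝟙)))) => i.
apply: (locid_iso lL _ (H i)); apply: isomorphic_trans (tensC x _).
apply: isomorphic_trans (isomorphic_sym (projection_formula (adj i) x 𝟙)).
have [a] := tens1r (f i x); constructor; exact: (fmap_iso (g i) (iso_sym a)).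
Qed.

Lemma joint_conservative (x : T) : (forall i, is_zero (f i x)) -> is_zero x.
Proof.
move=> x0; apply: (joint_descent (localizing_ideal_zero T)) => i.
exact: adjoint_zero (adj i) _ (x0 i).
Qed.

End Descent.

Lemma supp_union_preimage (T S : bigtt) (f : geometric T S) (Y : set (Spc T)) :
  supp_union Y -> supp_union (Spc_map f @^-1` Y).
Proof.
move=> uY Q /uY[z [[cz zY] zQ]]; exists (f z); split; last by move=> Qz; exact: zQ.
split; first exact: geometric_compacts.
by move=> R Rz; apply: zY => -[].
Qed.

Lemma is_g_ex (T : bigtt) (P : Spc T) :
  weakly_noetherian (Spc T) -> exists G, is_g P G.
Proof.
move=> /(_ P)[Y1 [Y2 [tY1 tY2 PE]]].
have [e1 [f1 t1]] := idempotent_triangle_ex Y1.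
have [e2 [f2 t2]] := idempotent_triangle_ex Y2.
by exists (e1 ⊗ f2), Y1, Y2, e1, f1, e2, f2.
Qed.

Section GImage.
Variables (T S : bigtt) (f : geometric T S) (P : Spc T) (G : T).
Hypothesis PG : is_g P G.

(** This inclusion holds at every point of the fibre over [P] and serves the local-to-global
    principle. The reverse one, for minimality, asks that [Q] be the whole fibre. *)
Lemma is_g_image_le (Q : Spc S) (G' : S) :
  Spc_map f Q = P -> is_g Q G' -> Loc [set f G] G'.
Proof.
move: PG => [Y1 [Y2 [e1 [f1 [e2 [f2 [tY1 tY2 PE [t1 t2] ->]]]]]]] QP.
move=> [Y1' [Y2' [e1' [f1' [e2' [f2' [tY1' tY2' QE [t1' t2'] ->]]]]]]].
have u1 := thomason_supp_union tY1; have u2 := thomason_supp_union tY2.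
suff : Loc [set f e1 ⊗ f f2] (e1' ⊗ f2').
  apply: Loc_sub => _ ->; apply: (locid_iso (Loc_ideal _)).
    exact/isomorphic_sym/geometric_tens.
  exact: Loc_gen.
apply: (idempotent_compare t1' t2' (idempotent_image f u1 t1)
  (idempotent_image f u2 t2)).
- exact: thomason_supp_union.
- exact: supp_union_preimage.
- by rewrite -QE => _ ->; have : [set P] (Spc_map f Q) by []; rewrite PE.
Qed.

Lemma is_g_image_ge (Q : Spc S) (G' : S) :
  (forall R, Spc_map f R = P -> R = Q) -> is_g Q G' -> Loc [set G'] (f G).
Proof.
move: PG => [Y1 [Y2 [e1 [f1 [e2 [f2 [tY1 tY2 PE [t1 t2] ->]]]]]]] QP.
move=> [Y1' [Y2' [e1' [f1' [e2' [f2' [tY1' tY2' QE [t1' t2'] ->]]]]]]].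
have u1 := thomason_supp_union tY1; have u2 := thomason_supp_union tY2.
apply: (locid_iso (Loc_ideal _) (geometric_tens f e1 f2)).
apply: (idempotent_compare (idempotent_image f u1 t1)
  (idempotent_image f u2 t2) t1' t2').
- exact: supp_union_preimage.
- exact: thomason_supp_union.
- by rewrite -QE => R /= H; apply: QP; have : [set P] (Spc_map f R) by rewrite PE.
Qed.

Lemma is_g_image_zero : (forall Q, Spc_map f Q <> P) -> is_zero (f G).
Proof.
move: PG => [Y1 [Y2 [e1 [f1 [e2 [f2 [tY1 tY2 PE [t1 t2] ->]]]]]]] NP.
have u1 := thomason_supp_union tY1; have u2 := thomason_supp_union tY2.
apply: is_zero_iso (isomorphic_sym (geometric_tens f e1 f2)) _.
apply: (idempotent_zero (idempotent_image f u1 t1) (idempotent_image f u2 t2)).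
move=> Q Y1Q; apply: contrapT => NY2Q; apply: (NP Q).
by have : [set P] (Spc_map f Q) by rewrite PE.
Qed.

End GImage.

Theorem theorem1p2 (I : small) (T : bigtt) (Ti : I -> bigtt)
    (f : forall i : I, geometric T (Ti i))
    (g : forall i : I, functor (Ti i) T)
    (adj : forall i : I, is_right_adjoint (f i) (g i))
    (wnT : weakly_noetherian (Spc T))
    (wnTi : forall i : I, weakly_noetherian (Spc (Ti i)))
    (unit_in : Loc [set coprod (tt_cop T) (fun i : I => g i (𝟙 : Ti i))]
                   (𝟙 : T))
    (stratTi : forall i : I, stratified (Ti i))
    (inj_Spc : injective (fun Q : {i : I & Spc (Ti i)} =>
                            Spc_map (f (projT1 Q)) (projT2 Q))) :
  stratified T.
Proof.
split=> //; split=> [x|P G PG y Gy Ny].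
  apply: (joint_descent adj unit_in (Loc_ideal _)) => i.
  apply: (adjoint_Loc (adj i)); have [_ [/(_ (f i x)) l2g _]] := stratTi i.
  apply: Loc_sub l2g => _ [Q [G' [QG' ->]]].
  (* The image of the object at the point below [Q] generates [G'], so [G' ⊗ f i x] is generated by
     the image of [G ⊗ x]. *)
  have [G PG] := is_g_ex (Spc_map (f i) Q) wnT.
  set L := Loc _; have lL : localizing_ideal L by exact: Loc_ideal.
  apply: (Loc_min (localizing_ideal_tensr (f i x) lL) _ (is_g_image_le PG erefl QG')).
  move=> _ -> /=; apply: (locid_iso lL (isomorphic_sym (geometric_tens (f i) G x))).
  by apply: Loc_gen; exists (G ⊗ x) => //; exists (Spc_map (f i) Q), G.
apply/seteqP; split; first by apply: Loc_sub => _ ->.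
apply: Loc_sub => _ ->; have ly := Loc_ideal [set y].
have fGy i : Loc [set f i G] (f i y).
  apply: (Loc_min (geometric_preimage_ideal (f i) (Loc_ideal _)) _ Gy) => _ ->.
  exact: Loc_gen.
have [i Nfy] : exists i, ~ is_zero (f i y).
  apply: contrapT => /forallNP H; apply/Ny/(joint_conservative adj unit_in) => i.
  exact: contrapT (H i).
have [Q QP] : exists Q, Spc_map (f i) Q = P.
  apply: contrapT => /forallNP H; apply: Nfy.
  apply: (Loc_min (localizing_ideal_zero _) _ (fGy i)) => _ ->.
  exact: is_g_image_zero PG H.
apply: (joint_descent adj unit_in ly) => j.
have [[R RP]|/forallNP H] := EM (exists R, Spc_map (f j) R = P); last first.
  apply: (locid_zero ly); apply: (adjoint_zero (adj j)).
  exact: is_g_image_zero PG H.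
(* Injectivity across indices: two points over [P] have the same index, so only the functor that
   does not kill [y] remains. *)
have ij : i = j.
  have := @inj_Spc (existT _ i Q) (existT _ j R); rewrite /= QP RP.
  by move=> /(_ erefl)/(congr1 (@projT1 _ _)).
move: ij R RP => <- _ _ {j}; apply: (adjoint_Loc (adj i)); rewrite image_set1.
have [G' QG'] := is_g_ex Q (wnTi i).
have [_ [_ /(_ Q G' QG' (f i y)) minQ]] := stratTi i.
(* Injectivity within one index. The equality of dependent pairs carries a transport along a proof
   of [i = i], removed by proof irrelevance. *)
have uniqQ R : Spc_map (f i) R = P -> R = Q.
  move=> RP; have := @inj_Spc (existT _ i R) (existT _ i Q); rewrite /= QP RP.
  move=> /(_ erefl) E; move: (projT2_eq E).
  by rewrite (Prop_irrelevance (projT1_eq E) erefl).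
have G'G := is_g_image_ge PG uniqQ QG'.
rewrite minQ //; apply: (Loc_sub _ (fGy i)) => _ ->; exact: G'G.
Qed.
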